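(* Let $\Gamma$ be a group generated by a finite symmetric set $S$ and let $H$ be an invariant random subgroup of $\Gamma$. Then the following are equivalent: 1) $\rho(\mathrm{Sch}(\Gamma/H,S))=\rho(\mathrm{Cay}(\Gamma,S))$ almost surely; 2) $H$ is amenable almost surely.
   Context: A subset $S\subseteq\Gamma$ is symmetric if $s\in S$ implies $s^{-1}\in S$. $\mathrm{Sub}_\Gamma$ is the compact space of subgroups of the countable group $\Gamma$ with the topology inherited from the product topology on $\{0,1\}^\Gamma$ (Chabauty topology); $\Gamma$ acts on it by conjugation. An invariant random subgroup (IRS) of $\Gamma$ is a random subgroup of $\Gamma$ whose distribution is a Borel probability measure on $\mathrm{Sub}_\Gamma$ invariant under conjugation by all elements of $\Gamma$. For a subgroup $H\le\Gamma$, the Schreier graph $\mathrm{Sch}(\Gamma/H,S)$ has vertex set the set of right cosets $\Gamma/H=\{Hg\mid g\in\Gamma\}$, and for each $s\in S$ and each vertex $Hg$ an $s$-labeled edge from $Hg$ to $Hgs$ (loops and multiple edges allowed); the $s$-labeled edges are inverses of the $s^{-1}$-labeled edges. $\mathrm{Cay}(\Gamma,S)$ is the Schreier graph for $H=1$. The Markov operator $M$ on $\ell^2$ of the vertex set is $(Mf)(x)=\frac{1}{|S|}\sum_{s\in S}f(xs)$, and the spectral radius $\rho$ of the graph is the operator norm of $M$. *)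

(* Defs.v *)
From HB Require Import structures.
From mathcomp Require Import all_boot all_order all_algebra finmap.
From mathcomp Require Import all_classical all_reals all_analysis.

Set Implicit Arguments.
Unset Strict Implicit.
Unset Printing Implicit Defensive.

Import Order.TTheory GRing.Theory Num.Theory.
Import numFieldNormedType.Exports.

Local Open Scope classical_set_scope.
Local Open Scope ring_scope.

Section Subgroups.
Variable G : groupType.
Local Open Scope group_scope.

(** [{ptws G -> bool}] is [{0,1}^G] with the product topology; the coercion
    to [set_type] gives [subgroup_space] the subspace (Chabauty) topology. *)
Definition subgroup_set : set {ptws G -> bool} :=
  [set H | group_closed (H : {pred G})].

Definition subgroup_space : Type := subgroup_set.
HB.instance Definition _ := Topological.on subgroup_space.

Definition subgroup_pred (H : subgroup_space) : {pred G} := set_val H.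
Coercion subgroup_pred : subgroup_space >-> pred_sort.

Lemma subgroup_closed (H : subgroup_space) : group_closed H.
Proof. exact: set_valP. Qed.

Definition Subgroup (H : {pred G}) (cH : group_closed H) : subgroup_space :=
  exist _ (H : {ptws G -> bool})
    (mem_set (cH : subgroup_set (H : {ptws G -> bool}))).

Lemma trivial_closed : group_closed (pred1 (1 : G)).
Proof.
split; first by rewrite inE.
by move=> x y; rewrite !inE => /eqP -> /eqP ->; rewrite mulgV.
Qed.

Definition trivial_subgroup : subgroup_space := Subgroup trivial_closed.

HB.instance Definition _ := isPointed.Build subgroup_space trivial_subgroup.

Definition borel_subgroups := g_sigma_algebraType (@open subgroup_space).
HB.instance Definition _ := Measurable.on borel_subgroups.

(** [x] belongs to [g^-1 H g] iff [g x g^-1] belongs to [H]. *)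
Lemma conj_closed (H : subgroup_space) (g : G) :
  group_closed [pred x | g * x * g^-1 \in H].
Proof.
have [H1 HV] := subgroup_closed H; split; first by rewrite inE mulg1 mulgV.
move=> x y; rewrite !inE => Hx Hy.
suff -> : g * (x * y^-1) * g^-1 = (g * x * g^-1) * (g * y * g^-1)^-1.
  exact: HV.
by rewrite !invgM invgK !mulgA mulgVK.
Qed.

Definition conj_subgroup (g : G) (H : subgroup_space) : subgroup_space :=
  Subgroup (conj_closed H g).

Definition symmetric_set (S : {fset G}) : Prop :=
  forall s, s \in S -> s^-1 \in S.

Definition generates (S : {fset G}) : Prop :=
  forall K : subgroup_space, {subset S <= K} -> forall x, x \in K.

Definition subgroup_type (H : subgroup_space) : Type := {x : G | x \in H}.

HB.instance Definition _ (H : subgroup_space) := SubChoice.on (subgroup_type H).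
HB.instance Definition _ (H : subgroup_space) :=
  SubChoice_isSubGroup.Build G (fun x => x \in H) (subgroup_type H)
    (subgroup_closed H).

End Subgroups.

Definition invariant_random_subgroup (R : realType) (G : groupType)
    (d : measure_display) (Omega : measurableType d) (P : probability Omega R)
    (H : {RV P >-> borel_subgroups G}) : Prop :=
  forall (g : G) (A : set (borel_subgroups G)), measurable A ->
    distribution P H (conj_subgroup g @^-1` A) = distribution P H A.

(** Existence of a left-invariant finitely additive probability measure
    defined on all subsets. *)
Definition amenable (R : realType) (G : groupType) : Prop :=
  exists m : set G -> R,
    [/\ forall A, 0 <= m A,
        m [set: G] = 1,
        forall A B, A `&` B = set0 -> m (A `|` B) = m A + m B
      & forall (g : G) A, m [set (g * x)%g | x in A] = m A].

(** For each label [s] in [labels] and each vertex [x] there is one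
    [s]-labeled edge, from [x] to [step x s]; the value of [step] at other
    elements of [G] is irrelevant. *)
Record labeled_graph (G : groupType) := LabeledGraph {
  vertex : choiceType;
  labels : {fset G};
  step : vertex -> G -> vertex
}.

Section Schreier.
Variable G : groupType.
Local Open Scope group_scope.

Definition rcoset_set (H : subgroup_space G) (g : G) : set G :=
  [set h * g | h in [set x | x \in H]].

Definition rcosets_set (H : subgroup_space G) : set (set G) :=
  range (rcoset_set H).

Lemma rcosets_step (H : subgroup_space G) (A : rcosets_set H) (s : G) :
  rcosets_set H [set a * s | a in set_val A].
Proof.
have [g _ Ag] := set_valP A; exists (g * s) => //; rewrite set_valE -Ag.
apply/seteqP; split => x /=.
  by move=> [h Hh <-]; exists (h * g); [exists h | rewrite mulgA].
by move=> [_ [h Hh <-] <-]; exists h => //; rewrite mulgA.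
Qed.

Definition schreier_step (H : subgroup_space G) (A : rcosets_set H) (s : G) :
  rcosets_set H :=
  exist _ [set a * s | a in set_val A] (mem_set (rcosets_step A s)).

Definition schreier (H : subgroup_space G) (S : {fset G}) : labeled_graph G :=
  {| vertex := set_type (rcosets_set H) : choiceType;
     labels := S;
     step := @schreier_step H |}.

Definition cayley (S : {fset G}) : labeled_graph G :=
  schreier (trivial_subgroup G) S.

End Schreier.

Section SpectralRadius.
Variables (R : realType) (G : groupType) (X : labeled_graph G).

Definition l2norm (f : vertex X -> R) : \bar R :=
  ((\esum_(x in [set: vertex X]) ((f x) ^+ 2)%:E) `^ (2^-1))%E.

Definition markov_op (f : vertex X -> R) (x : vertex X) : R :=
  (#|` labels X|%:R)^-1 * \sum_(s <- labels X) f (step x s).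

(** Operator norm of [markov_op] on real-valued square-summable functions (those
    with finite [l2norm]).  As the matrix of [markov_op] has real entries, its
    norm on complex square-summable functions is the same. *)
Definition spectral_radius : \bar R :=
  ereal_sup [set l2norm (markov_op f) | f in [set f | (l2norm f <= 1)%E]].

End SpectralRadius.

(* Main.v *)
Require Import Defs.
From HB Require Import structures.
From mathcomp Require Import all_boot all_order all_algebra finmap.
From mathcomp Require Import all_classical all_reals all_analysis.
From mathcomp Require Import measurable_realfun lra zify.

Set Implicit Arguments.
Unset Strict Implicit.
Unset Printing Implicit Defensive.

Import Order.TTheory GRing.Theory Num.Theory.
Import numFieldNormedType.Exports.

Local Open Scope classical_set_scope.
Local Open Scope ring_scope.

(* For every H the spectral radius of Sch(Gamma/H, S) is at least that of the
   Cayley graph, since closed walks from 1 in Gamma project to closed walks at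
   the root.

   If H is amenable, equality holds.  For L larger than the norm of the
   adjacency operator of the Cayley graph, its Green function u at L is positive
   and satisfies sum_s u(x s) <= L u(x).  The ratios u(h^-1 x s) / u(h^-1 x),
   averaged over h in H by an invariant mean, are functions on the edges of
   Sch(Gamma/H, S), to which Schur's test applies with the constant L.

   Conversely, suppose that H is nonamenable with positive probability.  Then
   there are a finite F containing 1 and kap < |F| such that F is contained in H
   with probability p > 0 and the sum of the right translations by F has norm at
   most kap on l^2(Gamma): otherwise almost maximising vectors would yield an
   invariant mean.  Let W be the multiset of words of length L in S and 1, with
   L so large that F is contained in W; its adjacency operator is the L-th power
   of 1 + sum S.  Give each step of a W-walk that lies in F the weight
   z = |F| / kap when it starts at a good point x, i.e., one with x F x^-1
   contained in H.  Such a step stays in the coset H x, and the gap of F absorbs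
   z: in Gamma, the weighted closed walks of length n are bounded by the
   unweighted ones in Sch(Gamma/H, S), hence by B^n, where B is the norm bound in
   the Schreier graph.  By invariance a given point is good with probability p,
   so Jensen's inequality, applied to each closed walk in Gamma, shows that the
   walks in Gamma with the weight z^p on all F-steps are still bounded by B^n.
   As F contains 1, this weight adds a positive multiple of the identity to the
   operator on Gamma, so the norm on the Cayley graph is strictly smaller. *)

(** * Square-summable functions *)

Section SquareSums.
Context {R : realType} {T : choiceType}.
Implicit Types (D E : set T) (f g : T -> R) (a b c : R).

(* [l2le D f a] says that the [l^2] norm of [f] on [D] is at most [a]. *)
Definition l2le D f a := 0 <= a /\ forall s : seq T, uniq s ->
  (forall x, x \in s -> D x) -> \sum_(x <- s) f x ^+ 2 <= a ^+ 2.

Lemma l2le_eq D f g a : {in D, f =1 g} -> l2le D f a -> l2le D g a.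
Proof.
move=> fg [a0 fa]; split=> // s us sD; apply: le_trans (fa s us sD).
by rewrite le_eqVlt (eq_big_seq (fun x => f x ^+ 2)) ?eqxx// => x /sD Dx; rewrite fg// inE.
Qed.

Lemma l2le_sub D E f a : D `<=` E -> l2le E f a -> l2le D f a.
Proof. by move=> DE [a0 fa]; split=> // s us sD; apply: fa => // x /sD /DE. Qed.

Lemma l2le_le D f a b : a <= b -> l2le D f a -> l2le D f b.
Proof.
move=> ab [a0 fa]; split; first exact: le_trans ab.
move=> s us sD; apply: le_trans (fa s us sD) _.
by rewrite ler_sqr ?nnegrE// (le_trans a0).
Qed.

Lemma l2le_point D f a x : D x -> l2le D f a -> f x <= a.
Proof.
move=> Dx [a0 /(_ [:: x] isT)]; rewrite big_seq1 => fa.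
have : f x ^+ 2 <= a ^+ 2 by apply: fa => y; rewrite inE => /eqP->.
have [fx0 _|fx0] := leP (f x) 0; first exact: le_trans fx0 a0.
by rewrite ler_sqr ?nnegrE// ltW.
Qed.

Lemma l2le0 D f : {in D, forall x, f x = 0} -> l2le D f 0.
Proof.
move=> f0; split=> // s us sD; rewrite big1_seq ?expr0n// => x /= /sD Dx.
by rewrite f0 ?inE// expr0n.
Qed.

Lemma l2le_dirac D (x0 : T) : l2le D (fun x => (x == x0)%:R) 1.
Proof.
split=> // s us _; rewrite expr1n.
rewrite (eq_bigr (fun x => if x == x0 then 1 else 0)) => [|x _]; last first.
  by case: eqP; rewrite ?expr1n ?expr0n.
rewrite -big_mkcond/= big_const_seq iter_addr_0 count_uniq_mem//.
by rewrite -[leRHS]/(1%:R) ler_nat; case: (_ \in _).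
Qed.

Lemma l2leZ D f a c : 0 <= c -> l2le D f a -> l2le D (fun x => c * f x) (c * a).
Proof.
move=> c0 [a0 fa]; split=> [|s us sD]; first exact: mulr_ge0.
under eq_bigr do rewrite exprMn.
by rewrite -mulr_sumr exprMn ler_wpM2l ?sqr_ge0// fa.
Qed.

Lemma l2leD D f g a b :
  l2le D f a -> l2le D g b -> l2le D (fun x => f x + g x) (a + b).
Proof.
move=> [a0 fa] [b0 gb]; split=> [|s us sD]; first exact: addr_ge0.
have {}fa := fa s us sD; have {}gb := gb s us sD.
have h0 (h : T -> R) : \sum_(x <- s) h x ^+ 2 <= 0 -> {in s, forall x, h x = 0}.
  move=> hs x xs; apply/eqP; rewrite -sqrf_eq0 eq_le sqr_ge0 andbT.
  apply: le_trans hs; rewrite (big_rem x)//= lerDl sumr_ge0// => y _.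
  exact: sqr_ge0.
(* The weights [b / a] and [a / b] used below need nonzero bounds; a zero bound forces its function
   to vanish on [s]. *)
have [a_eq0|a_neq0] := eqVneq a 0.
  rewrite a_eq0 add0r (eq_big_seq (fun x => g x ^+ 2))// => x xs.
  by rewrite (h0 f) ?add0r//; rewrite a_eq0 expr0n in fa.
have [b_eq0|b_neq0] := eqVneq b 0.
  rewrite b_eq0 addr0 (eq_big_seq (fun x => f x ^+ 2))// => x xs.
  by rewrite (h0 g) ?addr0//; rewrite b_eq0 expr0n in gb.
have {a0 a_neq0} a0 : 0 < a by rewrite lt_def a_neq0.
have {b0 b_neq0} b0 : 0 < b by rewrite lt_def b_neq0.
(* The cross term is split by the inequality of means, with weights for which the two final bounds
   add up to exactly [(a + b) ^+ 2]. *)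
have amgm x : (f x + g x) ^+ 2 <= (1 + b / a) * f x ^+ 2 + (1 + a / b) * g x ^+ 2.
  have := sqr_ge0 (b * f x - a * g x).
  rewrite -(pmulr_rge0 _ (_ : 0 < a^-1 * b^-1)) ?mulr_gt0 ?invr_gt0//.
  have aV : a^-1 * a = 1 by rewrite mulVf// gt_eqF.
  have bV : b^-1 * b = 1 by rewrite mulVf// gt_eqF.
  have -> : a^-1 * b^-1 * (b * f x - a * g x) ^+ 2 =
      (a^-1 * b) * (b^-1 * b) * f x ^+ 2 + (a^-1 * a) * (b^-1 * a) * g x ^+ 2
      - 2 * (a^-1 * a) * (b^-1 * b) * f x * g x by lra.
  rewrite aV bV; lra.
apply: (@le_trans _ _ ((1 + b / a) * a ^+ 2 + (1 + a / b) * b ^+ 2)); last first.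
  rewrite !mulrDl !mul1r !expr2 -!mulrA !(mulrA _^-1) !mulVf ?gt_eqF//; lra.
apply: le_trans (ler_sum _ (fun x _ => amgm x)) _.
rewrite big_split/= -!mulr_sumr lerD//.
  by rewrite ler_wpM2l// addr_ge0// divr_ge0// ltW.
by rewrite ler_wpM2l// addr_ge0// divr_ge0// ltW.
Qed.

Lemma l2le_sum (I : eqType) (r : seq I) D (f : I -> T -> R) (a : I -> R) :
  (forall i, i \in r -> l2le D (f i) (a i)) ->
  l2le D (fun x => \sum_(i <- r) f i x) (\sum_(i <- r) a i).
Proof.
elim: r => [_|i r IH fa].
  by rewrite big_nil; apply: l2le0 => x _; rewrite big_nil.
rewrite big_cons; apply: l2le_eq (l2leD (fa i (mem_head i r))
  (IH (fun j jr => fa j (mem_behead (s := i :: r) jr)))) => x _.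
by rewrite big_cons.
Qed.

Lemma l2norm_le (G : groupType) (X : labeled_graph G) (f : vertex X -> R) a :
  0 <= a -> (l2norm f <= a%:E)%E <->
    forall s : seq (vertex X), uniq s -> \sum_(x <- s) f x ^+ 2 <= a ^+ 2.
Proof.
move=> a0.
pose e := (\esum_(x in [set: vertex X]) ((f x) ^+ 2)%:E)%E.
have e0 : (0 <= e)%E by apply: esum_ge0 => x _; rewrite lee_fin sqr_ge0.
have ea2 : (l2norm f <= a%:E)%E <-> (e <= (a ^+ 2)%:E)%E.
  rewrite /l2norm -/e; split => h.
    have: ((e `^ 2^-1) `^ 2%:R <= a%:E `^ 2%:R)%E.
      by apply: gt0_ler_poweR => //; rewrite in_itv/= ?leey ?poweR_ge0 ?lee_fin ?a0.
    by rewrite -poweRrM mulVf// poweRe1// poweR_EFin powR_mulrn.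
  have: (e `^ 2^-1 <= (a ^+ 2)%:E `^ 2^-1)%E.
    by apply: gt0_ler_poweR => //; rewrite ?in_itv/= ?leey ?lee_fin ?sqr_ge0 ?e0 ?invr_ge0.
  by rewrite -powR_mulrn// -poweR_EFin -poweRrM mulfV// poweRe1// lee_fin.
rewrite ea2; split => [ea s us|fa].
  have : ((\sum_(x <- s) f x ^+ 2)%:E <= e)%E.
    apply: ereal_sup_ubound; exists [set` s].
      by split; [exact: finite_seq|exact: subsetT].
    by rewrite -fsbig_seq// sumEFin.
  by move=> /le_trans/(_ ea); rewrite lee_fin.
apply: ge_ereal_sup => _ [F [finF _] <-].
by rewrite fsbig_finite//= sumEFin lee_fin fa.
Qed.

End SquareSums.

(** * Translation operators and Schreier graphs *)

Lemma ler_sum_subseq (R : numDomainType) (T : eqType) (s1 s2 : seq T)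
    (F : T -> R) : uniq s1 -> uniq s2 -> {subset s1 <= s2} ->
  (forall x, 0 <= F x) -> \sum_(x <- s1) F x <= \sum_(x <- s2) F x.
Proof.
move=> u1 u2 s12 F0; rewrite [leRHS](bigID (mem s1))/= -[leLHS]addr0 lerD ?sumr_ge0//.
rewrite -[leRHS]big_filter; 
suff s1E : perm_eq s1 [seq x <- s2 | x \in s1] by rewrite (perm_big _ s1E).
apply: uniq_perm; rewrite ?filter_uniq// => x.
by rewrite mem_filter andb_idr// => /s12.
Qed.

Section Translations.
Context {R : realType} {G : groupType}.

Definition tsum (X : Type) (act : X -> G -> X) (W : seq G) (f : X -> R) (x : X)
  : R := \sum_(g <- W) f (act x g).

(** Repetitions are kept, one entry per word of length [n], so that [tsum] over this list is exactly
    the [n]-th power of the operator. *)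
Fixpoint prods (W : seq G) (n : nat) : seq G :=
  if n is n'.+1 then [seq (g * h)%g | g <- W, h <- prods W n'] else [:: 1%g].

Section Action.
Context {X : choiceType} (act : X -> G -> X).
Hypothesis act1 : forall x, act x 1%g = x.
Hypothesis actM : forall x g h, act (act x g) h = act x (g * h)%g.
Implicit Types (D E : set X) (W : seq G) (f : X -> R) (a : R).

Let actK g : cancel (act^~ g) (act^~ g^-1%g).
Proof. by move=> x; rewrite actM mulgV act1. Qed.

Lemma iter_tsum W n f x : iter n (tsum act W) f x = tsum act (prods W n) f x.
Proof.
elim: n x => [|n IH] x; first by rewrite /tsum big_seq1 act1.
rewrite iterS {1}/tsum /tsum/= big_allpairs_dep/=; apply: eq_bigr => g _.
by rewrite IH; apply: eq_bigr => h _; rewrite actM.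
Qed.

Lemma l2le_act D E f a g : (forall x, D x -> E (act x g)) ->
  l2le E f a -> l2le D (fun x => f (act x g)) a.
Proof.
move=> DE [a0 fa]; split=> // s us sD.
rewrite -(big_map (act^~ g) predT (fun x => f x ^+ 2)); apply: fa.
  by rewrite map_inj_uniq//; exact: can_inj (actK g).
by move=> _ /mapP[x /sD /DE Ex ->].
Qed.

Lemma l2le_tsum W f a :
  l2le setT f a -> l2le setT (tsum act W f) ((size W)%:R * a).
Proof.
move=> fa.
have -> : (size W)%:R * a = \sum_(g <- W) a.
  by rewrite big_const_seq iter_addr_0 count_predT mulr_natl.
by apply: l2le_sum => g _; exact: l2le_act fa.
Qed.

Lemma l2le_iter (A : (X -> R) -> X -> R) (c : R) :
  (forall f a, l2le setT f a -> l2le setT (A f) (c * a)) ->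
  forall n f a, l2le setT f a -> l2le setT (iter n A f) (c ^+ n * a).
Proof.
move=> Ac n f a fa; elim: n => [|n IH]; first by rewrite expr0 mul1r.
by rewrite exprS -mulrA; exact: Ac.
Qed.

(** Schur's test. The bound on squares is Cauchy-Schwarz at [y], with weights on the reversed edges.
    After summation over [y] each term is moved to the other end of its edge, where the symmetry of
    [W] makes the total weight at most [L]. *)
Lemma l2le_schur W (r : X -> G -> R) (L : R) f a :
  perm_eq [seq g^-1%g | g <- W] W -> 0 <= L ->
  (forall y g, 0 <= r y g) ->
  (forall y, \sum_(g <- W) r y g <= L) ->
  (forall y, tsum act W f y ^+ 2 <=
     L * \sum_(g <- W) f (act y g) ^+ 2 * r (act y g) g^-1%g) ->
  l2le setT f a -> l2le setT (tsum act W f) (L * a).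
Proof.
move=> symW L0 r0 rL fL [a0 fa]; split=> [|s us _]; first exact: mulr_ge0.
apply: le_trans (ler_sum _ (fun y _ => fL y)) _.
rewrite -mulr_sumr exprMn expr2 -mulrA ler_wpM2l// exchange_big/=.
pose Z := undup [seq act y g | g <- W, y <- s].
apply: (@le_trans _ _ (\sum_(g <- W) \sum_(y <- Z) f y ^+ 2 * r y g^-1%g)).
  rewrite [leLHS]big_seq [leRHS]big_seq; apply: ler_sum => g gW.
  rewrite -(big_map (act^~ g) predT (fun y => f y ^+ 2 * r y g^-1%g)).
  apply: ler_sum_subseq; rewrite ?undup_uniq//.
  - by rewrite map_inj_uniq//; exact: can_inj (actK g).
  - by move=> _ /mapP[y ys ->]; rewrite mem_undup; apply/allpairsP; exists (g, y).
  - by move=> y; rewrite mulr_ge0 ?sqr_ge0.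
rewrite exchange_big/=.
apply: (@le_trans _ _ (\sum_(y <- Z) f y ^+ 2 * L)).
  apply: ler_sum => y _; rewrite -mulr_sumr ler_wpM2l ?sqr_ge0//.
  by rewrite -(big_map (fun g => g^-1%g) predT (r y)) (perm_big _ symW).
by rewrite -mulr_suml mulrC ler_wpM2l// fa// undup_uniq.
Qed.

End Action.
End Translations.

Section SchreierGraph.
Context {R : realType} {G : groupType}.
Implicit Types (H : subgroup_space G) (S : {fset G}) (x g : G).

Definition vtx H x : rcosets_set H :=
  exist _ (rcoset_set H x) (mem_set (imageT (rcoset_set H) x)).

Lemma vtxP H (y : rcosets_set H) : exists x, y = vtx H x.
Proof. by have [x _ yx] := set_valP y; exists x; apply: val_inj; rewrite /= yx. Qed.

Lemma schreier_stepE H x g : schreier_step (vtx H x) g = vtx H (x * g)%g.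
Proof.
apply: val_inj; rewrite /= set_valE/=; apply/seteqP; split => y /=.
  by move=> [_ [h Hh <-] <-]; exists h => //; rewrite mulgA.
by move=> [h Hh <-]; exists (h * x)%g; [exists h|rewrite mulgA].
Qed.

Lemma sub1g H : 1%g \in H. Proof. by have [] := subgroup_closed H. Qed.

Lemma subMg H x g : x \in H -> g \in H -> (x * g)%g \in H.
Proof. exact: (group_closedM (subgroup_closed H)). Qed.

Lemma subVg H x : x \in H -> (x^-1)%g \in H.
Proof. exact: (group_closedV (subgroup_closed H)). Qed.

Lemma vtx_eqP H x x' : vtx H x = vtx H x' <-> (x' * x^-1)%g \in H.
Proof.
split=> [/(congr1 val)/= xx'|Hx].
  have : rcoset_set H x x'.
    by rewrite xx'; exists 1%g; [exact: sub1g|rewrite mul1g].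
  by move=> [h Hh <-]; rewrite mulgK.
apply: val_inj; apply/seteqP; split => y /= [h Hh <-].
  exists (h * (x' * x^-1)^-1)%g; first exact/subMg/subVg.
  by rewrite invgM invgK mulgA mulgVK.
exists (h * (x' * x^-1))%g; first exact: subMg.
by rewrite -!mulgA mulVg mulg1.
Qed.

Lemma schreier_step1 H (y : rcosets_set H) : schreier_step y 1%g = y.
Proof. by have [x ->] := vtxP y; rewrite schreier_stepE mulg1. Qed.

Lemma schreier_stepM H (y : rcosets_set H) g h :
  schreier_step (schreier_step y g) h = schreier_step y (g * h)%g.
Proof. by have [x ->] := vtxP y; rewrite !schreier_stepE mulgA. Qed.

Let Mtsum H S (f : rcosets_set H -> R) :
  markov_op (X := schreier H S) f =
  fun y => (#|` S|%:R)^-1 * tsum (@schreier_step G H) S f y.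
Proof. by []. Qed.

Lemma l2le_l2norm H S (f : rcosets_set H -> R) a : 0 <= a ->
  (l2norm (X := schreier H S) f <= a%:E)%E <-> l2le setT f a.
Proof.
move=> a0; rewrite l2norm_le//; split=> [fa|[_ fa] s us].
  by split=> // s us _; exact: fa.
exact: fa.
Qed.

Lemma spectral_radius_le H S (c : R) : 0 <= c ->
  (forall f a, l2le setT f a ->
     l2le setT (tsum (@schreier_step G H) S f) (c * a)) ->
  (spectral_radius R (schreier H S) <= ((#|` S|%:R)^-1 * c)%:E)%E.
Proof.
move=> c0 Sc; apply: ge_ereal_sup => _ [f /= f1 <-].
rewrite l2le_l2norm ?mulr_ge0 ?invr_ge0// Mtsum; apply: l2leZ; first by rewrite invr_ge0.
by rewrite -[c]mulr1; apply: Sc; rewrite -(l2le_l2norm S).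
Qed.

Lemma spectral_radius_ge0 H S : (0 <= spectral_radius R (schreier H S))%E.
Proof.
apply: ereal_sup_ge; exists (l2norm (X := schreier H S)
  (markov_op (X := schreier H S) (fun=> 0))); last exact: poweR_ge0.
exists (fun=> 0) => //=; rewrite l2le_l2norm//.
exact/(l2le_le ler01)/l2le0.
Qed.

Lemma spectral_radius_fin_num H S :
  spectral_radius R (schreier H S) \is a fin_num.
Proof.
rewrite ge0_fin_numE ?spectral_radius_ge0//.
apply: le_lt_trans (spectral_radius_le (c := (size S)%:R) _ _) (ltry _) => //.
by move=> f a; apply: l2le_tsum; [exact: schreier_step1|exact: schreier_stepM].
Qed.

Definition rho H S : R := fine (spectral_radius R (schreier H S)).

Lemma rhoE H S : spectral_radius R (schreier H S) = (rho H S)%:E.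
Proof. by rewrite fineK// spectral_radius_fin_num. Qed.

Lemma rho_ge0 H S : 0 <= rho H S.
Proof. by rewrite fine_ge0// spectral_radius_ge0. Qed.

Lemma rho_le H S (c : R) : 0 <= c ->
  (forall f a, l2le setT f a ->
     l2le setT (tsum (@schreier_step G H) S f) (c * a)) ->
  rho H S <= (#|` S|%:R)^-1 * c.
Proof. by move=> c0 Sc; rewrite -lee_fin -rhoE spectral_radius_le. Qed.

Lemma l2le_rho H S (f : rcosets_set H -> R) a : l2le setT f a ->
  l2le setT (tsum (@schreier_step G H) S f) (#|` S|%:R * rho H S * a).
Proof.
move=> fa; have a0 := fa.1.
(* Below, [f] is rescaled by [a^-1] to the unit ball; for [a = 0] the crude bound by the number of
   labels suffices. *)
have [a_eq0|a_neq0] := eqVneq a 0.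
  have := l2le_tsum (@schreier_step1 H) (@schreier_stepM H) S fa.
  by rewrite a_eq0 !mulr0.
have [S0|S0] := eqVneq #|` S| 0%N.
  rewrite S0 !mul0r; apply: l2le0 => y _.
  by move/cardfs0_eq: S0 => ->; rewrite /tsum big_nil.
have M1 : (l2norm (X := schreier H S)
    (markov_op (X := schreier H S) (fun y => a^-1 * f y)%R) <= (rho H S)%:E)%E.
  rewrite -rhoE; apply: ereal_sup_ubound => /=.
  exists (fun y => a^-1 * f y) => //=; rewrite l2le_l2norm//.
  by rewrite -(mulVf a_neq0); apply: l2leZ => //; rewrite invr_ge0.
move: M1; rewrite l2le_l2norm ?rho_ge0// Mtsum.
move=> /(l2leZ (c := #|` S|%:R * a) (mulr_ge0 (ler0n _ _) a0)).
rewrite mulrAC; apply: l2le_eq => y _.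
rewrite /tsum -mulr_sumr.
have SV : #|` S|%:R * (#|` S|%:R)^-1 = 1 :> R by rewrite mulfV ?pnatr_eq0.
have aV : a * a^-1 = 1 by rewrite mulfV.
rewrite mulrA mulrA (_ : _ * a * _ * _ = (#|` S|%:R * (#|` S|%:R)^-1) * (a * a^-1)).
  by rewrite SV aV !mul1r.
by rewrite -!mulrA; congr (_ * _); rewrite mulrCA.
Qed.

End SchreierGraph.

(** * Green functions *)

Section Green.
Context {R : realType} {G : groupType}.
Variables (W : seq G) (eta : R).
Hypothesis eta0 : 0 <= eta.
Implicit Types (f u : G -> R) (x y : G).

(** The loop of weight [eta] is the multiple of the identity gained in the nonamenable case; the
    amenable case takes [eta = 0]. *)
Definition walk_op f x : R := tsum *%g W f x + eta * f x.

Definition dirac1 (x : G) : R := (x == 1%g)%:R.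

Lemma walk_op_ge0 f : (forall x, 0 <= f x) -> forall x, 0 <= walk_op f x.
Proof. by move=> f0 x; rewrite addr_ge0 ?mulr_ge0// sumr_ge0. Qed.

Lemma iter_walk_op_ge0 n f :
  (forall x, 0 <= f x) -> forall x, 0 <= iter n walk_op f x.
Proof. by move=> f0; elim: n => //= n IH; exact: walk_op_ge0. Qed.

Lemma iter_walk_op_ge n f x y : (forall z, 0 <= f z) -> x \in prods W n ->
  f (y * x)%g <= iter n walk_op f y.
Proof.
move=> f0; elim: n x y => [|n IH] x y.
  by rewrite inE => /eqP->; rewrite mulg1.
move=> /allpairsP[[g h] [/= gW hW ->]]; rewrite mulgA.
apply: le_trans (IH _ _ hW) _; rewrite /walk_op /tsum (big_rem g)//=.
rewrite -addrA lerDl addr_ge0 ?mulr_ge0 ?sumr_ge0// => *;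
  exact: iter_walk_op_ge0.
Qed.

(* [u] is the Green function [sum_n L'^-n K^n dirac1], where [K] is [walk_op]. *)
Lemma green (L L' : R) : (forall x, exists n, x \in prods W n) -> 0 <= L ->
  (forall n, iter n walk_op dirac1 1%g <= L ^+ n) -> L < L' ->
  exists u : G -> R, (forall x, 0 < u x) /\
    (forall x, walk_op u x <= L' * u x).
Proof.
move=> gen L0 KL LL'; have L'0 : 0 < L' by exact: le_lt_trans LL'.
pose a x n := L' ^- n * iter n walk_op dirac1 x.
have d0 x : 0 <= dirac1 x by [].
have a0 x n : 0 <= a x n.
  by rewrite mulr_ge0 ?iter_walk_op_ge0// invr_ge0 exprn_ge0// ltW.
have ca x : cvgn (series (a x)).
  (* Prefixing a walk of length [m] from the identity to [x] turns walks from [x] to the identity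
     into closed walks, so a geometric series of ratio [L / L'] dominates. *)
  have [m xm] := gen x.
  apply: (@series_le_cvg _ _ (geometric (L ^+ m) (L / L'))) => // [n|n|].
  - by rewrite mulr_ge0 ?exprn_ge0// divr_ge0// ltW.
  - rewrite /a /= expr_div_n mulrA [leLHS]mulrC ler_wpM2r ?invr_ge0 ?exprn_ge0 ?(ltW L'0)//.
    rewrite -exprD; apply: le_trans (KL _); rewrite iterD -[x in leLHS]mul1g.
    by apply: iter_walk_op_ge => // z; exact: iter_walk_op_ge0.
  - apply: is_cvg_geometric_series.
    by rewrite ger0_norm ?divr_ge0 ?(ltW L'0)// ltr_pdivrMr// mul1r.
pose u x := limn (series (a x)).
have au x n : series (a x) n <= u x.
  apply: nondecreasing_cvgn_le => //; apply: nondecreasing_series => k _ _.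
  exact: a0.
(* The operator shifts the index: its value on a partial sum is [L'] times the next partial sum
   without its first term. *)
have Ka N x : walk_op (fun y => series (a y) N) x <= L' * u x.
  apply: (@le_trans _ _ (L' * series (a x) N.+1)); last by rewrite ler_wpM2l ?(ltW L'0).
  rewrite /walk_op /tsum /series/= exchange_big/= !mulr_sumr -big_split/=.
  rewrite [leRHS]big_nat_recl//= -[leLHS]add0r; apply: lerD.
    by rewrite mulr_ge0 ?(ltW L'0).
  rewrite le_eqVlt; apply/orP; left; apply/eqP.
  apply: eq_bigr => n _; rewrite /a iterS {2}/walk_op /tsum.
  have -> z : L' * (L' ^- n.+1 * z) = L' ^- n * z.
    by rewrite exprS invfM !mulrA mulfV ?gt_eqF// mul1r.
  by rewrite -mulr_sumr mulrDr; congr (_ + _); rewrite mulrCA.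
exists u; split => x.
  (* A word with product [x^-1] leads from [x] to the identity, so the term of index [m] is
     positive. *)
  have [m xm] := gen x^-1%g.
  apply: lt_le_trans (au x m.+1).
  rewrite /series/= big_nat_recr//= ltr_wpDl ?sumr_ge0//.
  rewrite mulr_gt0 ?invr_gt0 ?exprn_gt0//.
  apply: lt_le_trans (iter_walk_op_ge x d0 xm).
  by rewrite mulgV /dirac1 eqxx ltr01.
have cu : walk_op (fun y => series (a y) N) x @[N --> \oo] --> walk_op u x.
  apply: cvgD; last by apply: cvgMr; exact: ca.
  by apply: (cvg_big add_continuous) => g _; exact: ca.
rewrite -(cvg_lim _ cu)//; apply: limr_le; first by apply/cvg_ex; exists (walk_op u x).
by near=> N; exact: Ka.
Unshelve. all: by end_near. Qed.

End Green.

(** * Integration against a finitely additive mean *)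

Section FinitelyAdditiveMean.
Context {R : realType} {T : Type} (m : set T -> R).
Hypothesis m_ge0 : forall A, 0 <= m A.
Hypothesis m_setT : m setT = 1.
Hypothesis m_setU : forall A B, A `&` B = set0 -> m (A `|` B) = m A + m B.
Implicit Types (phi psi : T -> R) (v : R).

Let m_set0 : m set0 = 0.
Proof.
have := m_setU (setIid (set0 : set T)).
by rewrite setUid => /eqP; rewrite -subr_eq0 opprD addrA subrr add0r oppr_eq0 => /eqP.
Qed.

Let m_preimage (I : finType) (c : T -> I) (r : seq I) : uniq r ->
  m [set x | c x \in r] = \sum_(i <- r) m [set x | c x = i].
Proof.
elim: r => [_|i r IH /= /andP[ir ur]].
  by rewrite big_nil (_ : mkset _ = set0)//; apply/seteqP; split.
rewrite big_cons -IH// -m_setU.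
  congr (m _); apply/seteqP; split => x /=; rewrite inE.
    by move=> /orP[/eqP|]; [left|right].
  by case=> [->|->]; rewrite ?eqxx ?orbT.
by apply/seteqP; split => // x [/= ->]; rewrite (negPf ir).
Qed.

Let simple_sum (I : finType) (c : T -> I) (w : I -> R) :=
  \sum_i w i * m [set x | c x = i].

(** Used with [g] a projection of a product, this brings two simple functions to a common
    partition. *)
Let simple_sum_comp (I I' : finType) (c : T -> I) (g : I -> I') (w : I' -> R) :
  simple_sum c (w \o g) = simple_sum (g \o c) w.
Proof.
rewrite /simple_sum (partition_big g predT)//=; apply: eq_bigr => j _.
rewrite (eq_bigr (fun i => w j * m [set x | c x = i])); last first.
  by move=> i /eqP ->.
rewrite -mulr_sumr; congr (_ * _).
rewrite -big_filter -m_preimage ?filter_uniq ?index_enum_uniq//.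
congr (m _); apply/seteqP; split => x /=.
  by rewrite mem_filter => /andP[/eqP].
by move=> gx; rewrite mem_filter gx eqxx mem_index_enum.
Qed.

Let simple_sum_le (I : finType) (c : T -> I) (w w' : I -> R) :
  (forall x, w (c x) <= w' (c x)) -> simple_sum c w <= simple_sum c w'.
Proof.
move=> ww'; apply: ler_sum => i _.
have [[x /= <-]|/set0P/negP/negPn/eqP ->] := pselect ([set x | c x = i] !=set0).
  by rewrite ler_wpM2r.
by rewrite m_set0 !mulr0.
Qed.

(* [mintegral phi v] says that [phi] takes finitely many values and has integral
   [v] against the finitely additive measure [m]. *)
Definition mintegral phi v := exists (I : finType) (c : T -> I) (w : I -> R),
  phi =1 w \o c /\ v = simple_sum c w.

Lemma mintegral_le phi psi v v' : mintegral phi v -> mintegral psi v' ->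
  (forall x, phi x <= psi x) -> v <= v'.
Proof.
move=> [I [c [w [phiE ->]]]] [I' [c' [w' [psiE ->]]]] pp.
pose d x := (c x, c' x).
rewrite -[leLHS](simple_sum_comp d fst w) -[leRHS](simple_sum_comp d snd w').
by apply: simple_sum_le => x; have := pp x; rewrite phiE psiE.
Qed.

Lemma mintegral_cst v : mintegral (fun=> v) v.
Proof.
exists unit, (fun=> tt), (fun=> v); split => //.
rewrite /simple_sum (big_pred1 tt); last by case.
rewrite (_ : mkset _ = setT) ?m_setT ?mulr1//.
by apply/seteqP; split.
Qed.

Lemma mintegralD phi psi v v' : mintegral phi v -> mintegral psi v' ->
  mintegral (fun x => phi x + psi x) (v + v').
Proof.
move=> [I [c [w [phiE ->]]]] [I' [c' [w' [psiE ->]]]].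
pose d x := (c x, c' x).
exists (I * I')%type, d, (fun i => w i.1 + w' i.2); split.
  by move=> x; rewrite phiE psiE.
rewrite -[X in X + _](simple_sum_comp d fst w).
rewrite -[X in _ + X](simple_sum_comp d snd w').
by rewrite /simple_sum -big_split/=; apply: eq_bigr => i _; rewrite mulrDl.
Qed.

Lemma mintegralZ phi v a : mintegral phi v -> mintegral (fun x => a * phi x) (a * v).
Proof.
move=> [I [c [w [phiE ->]]]]; exists I, c, (fun i => a * w i); split.
  by move=> x; rewrite phiE.
by rewrite /simple_sum mulr_sumr; apply: eq_bigr => i _; rewrite mulrA.
Qed.

Lemma mintegral_sum (I : eqType) (r : seq I) (phi : I -> T -> R) (v : I -> R) :
  (forall i, i \in r -> mintegral (phi i) (v i)) ->
  mintegral (fun x => \sum_(i <- r) phi i x) (\sum_(i <- r) v i).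
Proof.
elim: r => [_|i r IH phiv].
  under eq_fun do rewrite big_nil; rewrite big_nil; exact: mintegral_cst.
under eq_fun do rewrite big_cons; rewrite big_cons.
apply: mintegralD; first by apply: phiv; rewrite mem_head.
by apply: IH => j jr; apply: phiv; rewrite inE jr orbT.
Qed.

Lemma mintegral_finite phi (s : seq R) : (forall x, phi x \in s) ->
  exists v, mintegral phi v.
Proof.
move=> phis; pose c x : 'I_(size s).+1 := inord (index (phi x) s).
pose w (i : 'I_(size s).+1) := s`_i.
exists (simple_sum c w), 'I_(size s).+1, c, w; split => // x.
by rewrite /w /= inordK ?nth_index// ltnS index_size.
Qed.

(** The default 0 keeps nonnegativity and shift invariance valid for every [phi]. *)
Definition mean phi : R := xget 0 [set v | mintegral phi v].

Lemma meanP phi v : mintegral phi v -> mintegral phi (mean phi).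
Proof. by move=> phiv; rewrite /mean; case: xgetP => [y ->|/(_ v)]. Qed.

Lemma mean_ge0 phi : (forall x, 0 <= phi x) -> 0 <= mean phi.
Proof.
move=> phi0; rewrite /mean; case: xgetP => [y -> phiy|]//.
exact: mintegral_le (mintegral_cst 0) phiy _.
Qed.

End FinitelyAdditiveMean.

Lemma mean_shift (R : realType) (G : groupType) (m : set G -> R) (h : G) phi :
  (forall (g : G) A, m [set (g * x)%g | x in A] = m A) ->
  mean m (fun x => phi (h * x)%g) = mean m phi.
Proof.
move=> mg; rewrite /mean; congr (xget 0 _).
have shift g psi v : mintegral m psi v -> mintegral m (fun x => psi (g * x)%g) v.
  move=> [I [c [w [psiE ->]]]]; exists I, (fun x => c (g * x)%g), w; split.
    by move=> x; rewrite psiE.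
  apply: eq_bigr => i _; rewrite -[in LHS](mg g^-1%g); congr (_ * m _).
  apply/seteqP; split => x /=.
    by move=> [y <- <-]; rewrite mulVKg.
  by move=> cx; exists (g * x)%g => //; rewrite mulKg.
apply/seteqP; split => v /=; last exact: shift.
move=> /(shift h^-1%g); rewrite (_ : (fun _ => _) = phi)//.
by apply/funext => x; rewrite mulVKg.
Qed.

(** Expand the nonnegative sum of [(f i - A / B * w i) ^+ 2 / w i], where [A] and [B] are the sums
    of [f] and [w]. *)
Lemma weighted_cauchy_schwarz (R : realFieldType) (I : eqType) (r : seq I)
    (f w : I -> R) : {in r, forall i, 0 < w i} ->
  (\sum_(i <- r) f i) ^+ 2 <= (\sum_(i <- r) w i) * \sum_(i <- r) f i ^+ 2 / w i.
Proof.
case: r => [|i0 r] w0; first by rewrite !big_nil expr0n mul0r.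
move: (i0 :: r) w0 (mem_head i0 r) => {}r w0 i0r.
set A := \sum_(i <- r) f i; set B := \sum_(i <- r) w i.
have B0 : 0 < B.
  rewrite /B big_seq_cond (big_rem i0)//= i0r/= ltr_wpDr ?w0//.
  by rewrite sumr_ge0// => i /andP[/w0 /ltW].
have : 0 <= \sum_(i <- r) (f i - A / B * w i) ^+ 2 / w i.
  by rewrite big_seq sumr_ge0// => i /w0 wi; rewrite divr_ge0 ?sqr_ge0// ltW.
rewrite (eq_big_seq (fun i => f i ^+ 2 / w i + ((A / B) ^+ 2 * w i - 2 * (A / B) * f i))).
  rewrite big_split/= sumrB -!mulr_sumr -/A -/B => h.
  rewrite -ler_pdivrMl//; have BV : B^-1 * B = 1 by rewrite mulVf// gt_eqF.
  have -> : B^-1 * A ^+ 2 = 2 * (A / B) * A - (A / B) ^+ 2 * B.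
    have -> : (A / B) ^+ 2 * B = A ^+ 2 * B^-1 * (B^-1 * B) by lra.
    by rewrite BV; lra.
  lra.
move=> i /w0 wi; have wV : w i * (w i)^-1 = 1 by rewrite mulfV// gt_eqF.
have -> : (f i - A / B * w i) ^+ 2 / w i = f i ^+ 2 / w i
   + ((A / B) ^+ 2 * w i * (w i * (w i)^-1) - 2 * (A / B) * f i * (w i * (w i)^-1)) by lra.
by rewrite wV !mulr1.
Qed.

(** * Amenable subgroups *)

Lemma floor_ln_bounds (R : realType) (u d : R) : 0 < u -> 0 < d ->
  expR (d * (Num.floor (ln u / d))%:~R) <= u
  < expR (d * (Num.floor (ln u / d))%:~R) * expR d.
Proof.
move=> u0 d0; have /andP[] := floor_itv (ln u / d); rewrite intrD.
have uE : u = expR (d * (ln u / d)) by rewrite mulrCA mulfV ?gt_eqF// mulr1 lnK.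
move: (ln u / d) (Num.floor _)%:~R uE => t n -> lo hi.
rewrite -expRD ler_expR ltr_expR ler_wpM2l ?(ltW d0)//=.
by rewrite -[X in _ + X]mulr1 -mulrDr ltr_pM2l.
Qed.

Lemma symmetric_perm (G : groupType) (S : {fset G}) : symmetric_set S ->
  perm_eq [seq g^-1%g | g <- S] S.
Proof.
move=> symS; apply: uniq_perm; rewrite ?map_inj_uniq ?fset_uniq//.
  exact: invg_inj.
move=> x; apply/mapP/idP => [[y yS ->]|xS]; first exact: symS.
by exists x^-1%g; [exact: symS|rewrite invgK].
Qed.

Section AmenableSchur.
Context {R : realType} {G : groupType}.
Variables (S : {fset G}) (symS : symmetric_set S) (H : subgroup_space G).
Variable m : set (subgroup_type H) -> R.
Hypothesis m_ge0 : forall A, 0 <= m A.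
Hypothesis m_setT : m setT = 1.
Hypothesis m_setU : forall A B, A `&` B = set0 -> m (A `|` B) = m A + m B.
Hypothesis m_shift : forall (g : subgroup_type H) A,
  m [set (g * x)%g | x in A] = m A.
Variables (u : G -> R) (L d : R).
Hypothesis u_gt0 : forall x, 0 < u x.
Hypothesis u_super : forall x, tsum *%g S u x <= L * u x.
Hypothesis d_gt0 : 0 < d.

(* Rounding [u] to powers of [expR d] makes the ratios [q (x * s) / q x] take
   finitely many values. *)
Let q x := expR (d * (Num.floor (ln (u x) / d))%:~R).
Let ratio x s := q (x * s)%g / q x.
Let avg x s := mean m (fun h => ratio ((\val h)^-1 * x)%g s).

Let q_gt0 x : 0 < q x. Proof. exact: expR_gt0. Qed.

Let ratio_gt0 x s : 0 < ratio x s. Proof. exact: divr_gt0. Qed.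

Let ratioV x s : (ratio x s)^-1 = ratio (x * s)%g s^-1%g.
Proof. by rewrite /ratio mulgK invf_div. Qed.

Let harnack x s : s \in S -> u (x * s)%g <= L * u x.
Proof.
move=> sS; apply: le_trans (u_super x).
by rewrite /tsum (big_rem s)//= lerDl sumr_ge0// => i _; exact: ltW.
Qed.

Let L_ge0 : 0 <= L.
Proof.
have := le_trans (sumr_ge0 _ (fun s _ => ltW (u_gt0 _))) (u_super 1%g).
by rewrite pmulr_lge0.
Qed.

Let ratio_sum x : \sum_(s <- S) ratio x s <= L * expR d.
Proof.
rewrite /ratio -mulr_suml ler_pdivrMr// -mulrA [expR d * _]mulrC.
apply: (@le_trans _ _ (L * u x)).
  apply: le_trans (u_super x); apply: ler_sum => t _.
  by have /andP[] := floor_ln_bounds (u_gt0 (x * t)%g) d_gt0.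
rewrite ler_wpM2l//.
by have /andP[_ /ltW] := floor_ln_bounds (u_gt0 x) d_gt0.
Qed.

(** The Harnack inequality bounds the increments of the rounded logarithm from above; applied to the
    reversed edge, it bounds them from below. Only finitely many integers remain. *)
Let ratio_finite : exists r : seq R, forall x s, s \in S -> ratio x s \in r.
Proof.
pose k x := Num.floor (ln (u x) / d).
have [K kK] : exists K : nat, forall x s, s \in S -> (k (x * s)%g - k x <= K%:Z)%R.
  have ub x s : s \in S -> (k (x * s)%g)%:~R - (k x)%:~R <= ln L / d + 1 :> R.
    move=> sS; have L0 : 0 < L.
      by rewrite -(pmulr_lgt0 _ (u_gt0 x)) (lt_le_trans _ (harnack x sS)).
    have /andP[lo _] := floor_itv (ln (u (x * s)%g) / d).
    have /andP[_] := floor_itv (ln (u x) / d); rewrite intrD => hi.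
    have : ln (u (x * s)%g) / d <= ln L / d + ln (u x) / d.
      rewrite -mulrDl ler_pM2r ?invr_gt0// -lnM ?posrE//.
      by rewrite ler_ln ?posrE ?mulr_gt0// harnack.
    rewrite /k; lra.
  exists (Num.bound `|ln L / d + 1|) => x s sS.
  rewrite -(ler_int R) rmorphB/= (le_trans (ub x s sS))//.
  exact/ltW/(le_lt_trans (ler_norm _))/archi_boundP.
have kK' x s : s \in S -> (- K%:Z <= k (x * s)%g - k x)%R.
  by move=> sS; have := kK (x * s)%g _ (symS sS); rewrite mulgK; lia.
exists [seq expR (d * (n%:Z - K%:Z)%:~R) | n <- iota 0 (K + K).+1] => x s sS.
have := kK x s sS; have := kK' x s sS; set D := k _ - k _ => D1 D2.
apply/mapP; exists (absz (D + K%:Z)); first by rewrite mem_iota; lia.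
have -> : (absz (D + K%:Z))%:Z - K%:Z = D by lia.
rewrite /ratio /q -expRN -expRD -mulrN -mulrDr -rmorphN -rmorphD/=.
by [].
Qed.

Let avgP x s : s \in S ->
  mintegral m (fun h => ratio ((\val h)^-1 * x)%g s) (avg x s).
Proof.
move=> sS; have [r rr] := ratio_finite.
have [v] := @mintegral_finite R _ m (fun h => ratio ((\val h)^-1 * x)%g s) r
  (fun h => rr _ _ sS).
exact: meanP.
Qed.

(** Invariance of the mean is used here: it makes [avg] a function on the edges of the Schreier
    graph. *)
Let avg_inv x s h : h \in H -> avg (h * x)%g s = avg x s.
Proof.
move=> hH; pose h' : subgroup_type H := exist _ h hH.
rewrite /avg -(mean_shift h' _ m_shift); congr mean.
by apply/funext => k; rewrite gmulfM/= invgM -mulgA mulKg.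
Qed.

Let avg_sum x : \sum_(s <- S) avg x s <= L * expR d.
Proof.
have I s : s \in S -> mintegral m _ (avg x s) := @avgP x s.
apply: (mintegral_le m_ge0 m_setU (mintegral_sum m_setT m_setU I)
  (mintegral_cst m_setT _)) => h.
exact: ratio_sum.
Qed.

(** Cauchy-Schwarz is applied at every translate [h^-1 x]. The reciprocal of a ratio is the ratio
    along the reversed edge, so the right side is linear in the ratios and the bound survives
    averaging over [h]. *)
Let avg_schur (c : G -> R) x : (\sum_(s <- S) c s) ^+ 2 <=
  L * expR d * \sum_(s <- S) c s ^+ 2 * avg (x * s)%g s^-1%g.
Proof.
have I s : s \in S -> mintegral m
    (fun h => c s ^+ 2 * ratio ((\val h)^-1 * (x * s))%g s^-1%g)
    (c s ^+ 2 * avg (x * s)%g s^-1%g).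
  by move=> sS; apply: mintegralZ; exact/avgP/symS.
apply: (mintegral_le m_ge0 m_setU (mintegral_cst m_setT _)
  (mintegralZ (L * expR d) (mintegral_sum m_setT m_setU I))) => h /=.
set z := ((\val h)^-1 * x)%g.
apply: le_trans (weighted_cauchy_schwarz c (fun s _ => ratio_gt0 z s)) _.
have -> : \sum_(s <- S) c s ^+ 2 * ratio ((\val h)^-1 * (x * s))%g s^-1%g =
    \sum_(s <- S) c s ^+ 2 / ratio z s.
  by apply: eq_bigr => s _; rewrite ratioV mulgA.
by rewrite ler_wpM2r ?ratio_sum// sumr_ge0// => s _; rewrite divr_ge0 ?sqr_ge0// ltW.
Qed.

Lemma l2le_amenable_schur (f : rcosets_set H -> R) a : l2le setT f a ->
  l2le setT (tsum (@schreier_step G H) S f) (L * expR d * a).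
Proof.
pose rep (y : rcosets_set H) := xget 1%g [set x | y = vtx H x].
have repP y : y = vtx H (rep y).
  rewrite /rep; case: xgetP => [x -> //|noy].
  by have [x yx] := vtxP y; have := noy x.
have avg_rep x s : avg (rep (vtx H x)) s = avg x s.
  have /vtx_eqP Hx := repP (vtx H x).
  by rewrite -(avg_inv x s Hx) mulgVK.
apply: (l2le_schur (@schreier_step1 G H) (@schreier_stepM G H)
  (r := fun y s => avg (rep y) s)) => //.
- exact: symmetric_perm.
- by rewrite mulr_ge0// expR_ge0.
- by move=> y s; apply: mean_ge0 => // h; exact: ltW.
- move=> y; have [x ->] := vtxP y.
  apply: le_trans (avg_schur _ x) _.
  rewrite le_eqVlt; apply/orP; left; apply/eqP; congr (_ * _).
  by apply: eq_bigr => s _; rewrite schreier_stepE avg_rep.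
Qed.

End AmenableSchur.

(** The rounding parameter [d] is arbitrary, and the loss [expR d] tends to 1 with it. *)
Lemma rho_le_of_superharmonic (R : realType) (G : groupType) (S : {fset G})
    (H : subgroup_space G) (u : G -> R) (L : R) :
  symmetric_set S -> amenable R (subgroup_type H) ->
  (forall x, 0 < u x) -> (forall x, tsum *%g S u x <= L * u x) ->
  rho H S <= (#|` S|%:R)^-1 * L.
Proof.
move=> symS [m [m0 mT mU mS]] u0 uL.
have L0 : 0 <= L.
  have := le_trans (sumr_ge0 _ (fun s _ => ltW (u0 _))) (uL 1%g).
  by rewrite pmulr_lge0.
have rhoL d : 0 < d -> rho H S <= (#|` S|%:R)^-1 * (L * expR d).
  move=> d0; apply: rho_le => [|f a]; first by rewrite mulr_ge0 ?expR_ge0.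
  exact: l2le_amenable_schur d0 f a.
rewrite leNgt; apply/negP => rL.
set r := rho H S in rhoL rL; set c := _ * L in rL.
have c_ge0 : 0 <= c by rewrite mulr_ge0 ?invr_ge0.
have [c0|c_neq0] := eqVneq c 0.
  by have := rhoL 1 ltr01; rewrite mulrA -/c c0 mul0r leNgt -c0 rL.
have c_gt0 : 0 < c by rewrite lt_def c_neq0.
(* For [d] the logarithm of this quotient, the bound [c * expR d] is the midpoint of [c] and [r],
   which lies below [r]. *)
have rc1 : 1 < (r + c) / 2 / c by rewrite ltr_pdivlMr// mul1r; lra.
have := rhoL (ln ((r + c) / 2 / c)) (ln_gt0 rc1).
rewrite lnK ?posrE ?(lt_trans ltr01)// (mulrA _ L) -/c [c * _]mulrC mulfVK//; lra.
Qed.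

(** * Words in the generators *)

Section Generation.
Context {G : groupType}.
Implicit Types (W : seq G) (S : {fset G}) (x y : G).

Lemma mem_prods1 W x : x \in W -> x \in prods W 1.
Proof. by move=> xW; apply/allpairsP; exists (x, 1%g); rewrite /= mulg1 inE. Qed.

Lemma mem_prodsM W m n x y :
  x \in prods W m -> y \in prods W n -> (x * y)%g \in prods W (m + n).
Proof.
elim: m x => [|m IH] x /=; first by rewrite inE => /eqP -> ?; rewrite mul1g.
move=> /allpairsP[[g h] [/= gW hm ->]] yn; rewrite -mulgA.
by apply/allpairsP; exists (g, (h * y)%g); split => //; exact: IH.
Qed.

Lemma mem_prodsV S n x :
  symmetric_set S -> x \in prods S n -> x^-1%g \in prods S n.
Proof.
move=> symS; elim: n x => [|n IH] x /=.
  by rewrite inE => /eqP ->; rewrite invg1 inE.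
move=> /allpairsP[[g h] [/= gS hn ->]]; rewrite invgM.
by have := mem_prodsM (IH _ hn) (mem_prods1 (symS _ gS)); rewrite addn1.
Qed.

Lemma generates_prods S : symmetric_set S -> generates S ->
  forall x, exists n, x \in prods S n.
Proof.
move=> symS genS.
pose K : {pred G} := fun x => `[< exists n, x \in prods S n >].
have KP x : reflect (exists n, x \in prods S n) (x \in K) by exact: asboolP.
have cK : group_closed K.
  split; first by apply/KP; exists 0%N; rewrite inE.
  move=> x y /KP[m xm] /KP[n yn]; apply/KP; exists (m + n)%N.
  exact/mem_prodsM/mem_prodsV.
move=> x; apply/KP; apply: (genS (Subgroup cK)) => s sS.
by apply/KP; exists 1%N; exact: mem_prods1.
Qed.

End Generation.

(** * Comparison of Schreier graphs with the Cayley graph *)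

Section Comparison.
Context {R : realType} {G : groupType}.
Variables (S : {fset G}) (symS : symmetric_set S) (genS : generates S).
Implicit Types (H : subgroup_space G) (W : seq G).

Definition dirac_root H (y : rcosets_set H) : R := (y == vtx H 1%g)%:R.

Lemma iter_tsum_dirac_le H W n x : iter n (tsum *%g W) dirac1 x <=
  iter n (tsum (@schreier_step G H) W) (@dirac_root H) (vtx H x) :> R.
Proof.
elim: n x => [|n IH] x /=.
  by rewrite /dirac1 /dirac_root ler_nat; case: eqP => // ->; rewrite eqxx.
by apply: ler_sum => g _; rewrite schreier_stepE.
Qed.

Lemma iter_tsum_rho H n :
  iter n (tsum (@schreier_step G H) S) (@dirac_root H) (vtx H 1%g) <=
  (#|` S|%:R * rho H S) ^+ n :> R.
Proof.
rewrite -[leRHS]mulr1.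
apply: l2le_point (l2le_iter _ n (l2le_dirac setT (vtx H 1%g))) => // f a.
exact: l2le_rho.
Qed.

(** The Green function of the group at [D + e] is positive and superharmonic for every [e > 0]. Only
    returns in the group enter, so one bound serves both [H] and the trivial subgroup. *)
Lemma rho_le_of_returns H (D : R) : amenable R (subgroup_type H) -> 0 <= D ->
  (forall n, iter n (tsum *%g S) dirac1 1%g <= D ^+ n) ->
  rho H S <= (#|` S|%:R)^-1 * D.
Proof.
move=> amH D0 returns; apply/ler_addgt0Pr => e e0.
have [||u [u0 uD]] := @green R G S 0 (lexx 0) D (D + e) (generates_prods symS genS) D0.
- move=> n; rewrite (_ : walk_op S 0 = tsum *%g S)//.
  by apply/funext => f; apply/funext => x; rewrite /walk_op mul0r addr0.
- by rewrite ltrDl.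
have := @rho_le_of_superharmonic R G S H u (D + e) symS amH u0.
rewrite /walk_op in uD; rewrite mulrDr => /(_ _)/le_trans; apply.
  by move=> x; have := uD x; rewrite mul0r addr0.
rewrite lerD2l ger_pMl//; case: #|` S| => [|k]; first by rewrite invr0.
by rewrite invf_le1// ler1n.
Qed.

(** The point mass at the identity is invariant. This makes the Cayley graph a case of the results
    on amenable subgroups. *)
Lemma amenable_trivial : amenable R (subgroup_type (trivial_subgroup G)).
Proof.
have all1 (x y : subgroup_type (trivial_subgroup G)) : x = y.
  by apply: val_inj; have /eqP -> := valP x; have /eqP -> := valP y.
pose m (A : set (subgroup_type (trivial_subgroup G))) : R := `[< A 1%g >]%:R.
exists m; split=> [A||A B AB0|g A]; rewrite /m.
- by [].
- by rewrite asboolT.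
- have [A1|A1] := pselect (A 1%g); have [B1|B1] := pselect (B 1%g).
  + by have : (A `&` B) 1%g by []; rewrite AB0.
  + by rewrite (asboolT (or_introl A1)) (asboolT A1) (asboolF B1) addr0.
  + by rewrite (asboolT (or_intror B1)) (asboolT B1) (asboolF A1) add0r.
  + by rewrite (asboolF A1) (asboolF B1) asboolF ?addr0// => -[].
- congr (_%:R); congr nat_of_bool; apply: asbool_equiv_eq; split.
    by move=> [x Ax _]; rewrite (all1 1%g x).
  by move=> A1; exists 1%g => //; exact: all1.
Qed.

Lemma rho_trivial_le H : rho (trivial_subgroup G) S <= rho H S :> R.
Proof.
have D0 : 0 <= #|` S|%:R * rho H S :> R by rewrite mulr_ge0// rho_ge0.
apply: le_trans (rho_le_of_returns amenable_trivial D0 _) _.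
  by move=> n; apply: le_trans (iter_tsum_rho H n); exact: iter_tsum_dirac_le.
rewrite mulrA; have [->|S0] := eqVneq #|` S| 0%N.
  by rewrite mulr0 mul0r rho_ge0.
by rewrite mulVf ?mul1r// pnatr_eq0.
Qed.

Lemma amenable_rho H : amenable R (subgroup_type H) ->
  rho H S = rho (trivial_subgroup G) S :> R.
Proof.
move=> amH; apply/eqP; rewrite eq_le rho_trivial_le andbT.
set D := rho (trivial_subgroup G) S.
have D0 : 0 <= #|` S|%:R * D :> R by rewrite mulr_ge0// rho_ge0.
apply: le_trans (rho_le_of_returns amH D0 _) _.
  move=> n; apply: le_trans (iter_tsum_rho (trivial_subgroup G) n).
  exact: iter_tsum_dirac_le.
rewrite mulrA; have [->|S0] := eqVneq #|` S| 0%N.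
  by rewrite mulr0 mul0r rho_ge0.
by rewrite mulVf ?mul1r// pnatr_eq0.
Qed.

End Comparison.

(** * Spectral gap of nonamenable subgroups *)

Lemma ultra_cvg (R : realType) (I : Type) (U : set_system I) (phi : I -> R) :
  UltraFilter U -> (forall i, 0 <= phi i <= 1) ->
  exists p : R, phi i @[i --> U] --> p.
Proof.
move=> ultraU phi01.
have [|p [_ clp]] := @segment_compact R 0 1 (phi @ U) _.
  by apply: (@filterS _ U _ setT) => [i _|]; [rewrite /= in_itv/=|exact: filterT].
exists p => V nV /=; have [//|UV] := in_ultra_setVsetC (phi @^-1` V) ultraU.
by by have [x [nVx Vx]] := clp (~` V) V UV nV.
Qed.

(** Approximate means are indexed by a finite set and a precision. Their limit along an ultrafilter
    that contains all cones [B i] is additive, and the invariance errors tend to 0. *)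
Lemma amenable_of_almost_invariant (R : realType) (K : groupType) :
  (forall (F : seq K) (e : R), 0 < e -> exists m : set K -> R,
    [/\ forall A, 0 <= m A, m setT = 1,
      forall A B, A `&` B = set0 -> m (A `|` B) = m A + m B
    & forall (g : K) A, g \in F -> `|m [set (g * x)%g | x in A] - m A| <= e]) ->
  amenable R K.
Proof.
move=> almost.
have inv_gt0 (n : nat) : 0 < n.+1%:R^-1 :> R by rewrite invr_gt0.
have [mu muP] := choice (fun i : seq K * nat => almost i.1 _ (inv_gt0 i.2)).
pose B (i : seq K * nat) :=
  [set j : seq K * nat | {subset i.1 <= j.1} /\ (i.2 <= j.2)%N].
have FB : Filter (filter_from setT B).
  apply: (@filter_from_filter _ _ setT B); first by exists ([::], 0%N).
  move=> i j _ _; exists (i.1 ++ j.1, maxn i.2 j.2) => // k [/= ijk].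
  rewrite geq_max => /andP[ik jk]; split; split=> // x xi; apply: ijk.
    by rewrite mem_cat xi.
  by rewrite mem_cat xi orbT.
have PB : ProperFilter (filter_from setT B).
  by apply: (filter_from_proper FB) => i _; exists i; split.
have [U [ultraU BU]] := ultraFilterLemma PB.
have mu01 A i : 0 <= mu i A <= 1.
  have [mu0 <- muU _] := muP i; rewrite mu0/= -(setUv A) muU ?setICr//.
  by rewrite lerDl.
have [m mP] := choice (fun A => ultra_cvg ultraU (mu01 A)).
have lim_eq (f : seq K * nat -> R) (a b : R) :
    f i @[i --> U] --> a -> f i @[i --> U] --> b -> a = b.
  by move=> fa fb; rewrite -(cvg_lim _ fa)// -(cvg_lim _ fb).
exists m; split=> [A||A C AC|g A].
- rewrite -(cvg_lim _ (mP A))//; apply: limr_ge; first by apply/cvg_ex; exists (m A).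
  by apply: nearW => i; have /andP[] := mu01 A i.
- apply: lim_eq (mP setT) _.
  by under eq_fun do rewrite (let: And4 _ h _ _ := muP _ in h); exact: cvg_cst.
- apply: lim_eq (mP _) _.
  rewrite (_ : (fun _ => _) = (fun i => mu i A + mu i C)); last first.
    by apply/funext => i; have [_ _ muU _] := muP i; exact: muU.
  exact: cvgD (mP A) (mP C).
- apply/eqP; rewrite -subr_eq0; apply/eqP.
  apply: (@lim_eq (fun i => mu i [set (g * x)%g | x in A] - mu i A)).
    exact: cvgB (mP _) (mP A).
  apply/cvgrPdist_le => e e0; apply: BU.
  have [n ne] := ltr_add_invr e0; rewrite add0r in ne.
  exists ([:: g], n) => // i [/= gi ni]; rewrite sub0r normrN.
  have [_ _ _ /(_ g A) inv] := muP i.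
  apply: le_trans (inv _) _; first by apply: gi; rewrite inE.
  by apply: le_trans (ltW ne); rewrite lef_pV2 ?posrE// ler_nat.
Qed.

Lemma sum_eq_supp (R : numDomainType) (T : eqType) (s1 s2 : seq T) (F : T -> R) :
  uniq s1 -> uniq s2 -> {subset s1 <= s2} ->
  (forall x, x \notin s1 -> F x = 0) -> \sum_(x <- s2) F x = \sum_(x <- s1) F x.
Proof.
move=> u1 u2 s12 F0; rewrite (bigID (mem s1))/= [X in _ + X]big1 ?addr0//.
rewrite -big_filter; apply: perm_big; apply: uniq_perm; rewrite ?filter_uniq// => x.
by rewrite mem_filter andb_idr// => /s12.
Qed.

(** The right side is four times the sum [V] of the squared deviations from the average; the squares
    of the deviations at [i] and [j] are at most [V], and the square of their difference is at most
    twice their sum. *)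
Lemma sqr_dist_le_variance (R : realFieldType) (I : eqType) (r : seq I)
    (a : I -> R) i j : i \in r -> j \in r ->
  (a i - a j) ^+ 2 <=
  4 * (\sum_(k <- r) a k ^+ 2 - (\sum_(k <- r) a k) ^+ 2 / (size r)%:R).
Proof.
move=> ir jr; set A := \sum_(k <- r) a k; set N : R := (size r)%:R.
have N0 : N != 0 by rewrite pnatr_eq0 -lt0n; case: r ir {jr A N}.
pose V := \sum_(k <- r) (a k - A / N) ^+ 2.
have VE : V = \sum_(k <- r) a k ^+ 2 - A ^+ 2 / N.
  have -> : V = \sum_(k <- r) (a k ^+ 2 + ((A / N) ^+ 2 - 2 * (A / N) * a k)).
    by apply: eq_bigr => k _; lra.
  rewrite big_split/= sumrB -[X in _ + (_ - X)]mulr_sumr -/A big_const_seq iter_addr_0 count_predT.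
  rewrite -[_ *+ size r]mulr_natl -/N.
  have -> : N * (A / N) ^+ 2 = (N / N) * (A ^+ 2 / N) by lra.
  rewrite mulfV//; lra.
have le_V k : k \in r -> (a k - A / N) ^+ 2 <= V.
  by move=> kr; rewrite /V (big_rem k)//= lerDl sumr_ge0// => *; exact: sqr_ge0.
rewrite -VE; have := le_V _ ir; have := le_V _ jr.
have := sqr_ge0 (a i - A / N + (a j - A / N)); lra.
Qed.

Section Gap.
Context {R : realType} {G : groupType}.
Implicit Types (F : seq G) (f : G -> R).

Definition gap F (kap : R) := forall f a,
  l2le setT f a -> l2le setT (tsum *%g F f) (kap * a).

(* A near-maximiser of the norm of [tsum *%g F] is almost invariant under [F]. *)
Lemma almost_invariant_of_not_gap F (eta : R) : uniq F -> 1%g \in F -> 0 < eta ->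
  (forall kap, 0 < kap < (size F)%:R -> ~ gap F kap) ->
  exists (Z X : seq G) f,
    [/\ uniq Z /\ uniq X,
        (forall x, x \notin Z -> f x = 0) /\ 0 < \sum_(x <- Z) f x ^+ 2,
        {subset Z <= X} /\
          (forall z t, z \in Z -> t \in F -> (z * t^-1)%g \in X)
      & forall t, t \in F -> \sum_(x <- X) (f (x * t)%g - f x) ^+ 2 <=
          eta * \sum_(x <- Z) f x ^+ 2].
Proof.
move=> uF F1 eta0 nogap; set N : R := (size F)%:R in nogap.
have N0 : 0 < N by rewrite ltr0n; case: F F1 {uF nogap N}.
(* This gives [8 * N * e <= eta], needed in the last estimate, and [e < 1], which makes [kap]
   positive. *)
pose e := eta / (8 * N + 2 * eta).
have D0 : 0 < 8 * N + 2 * eta by rewrite addr_gt0// mulr_gt0.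
have e0 : 0 < e by rewrite divr_gt0.
have eD : e * (8 * N + 2 * eta) = eta by rewrite mulfVK// gt_eqF.
have eN : 8 * N * e <= eta by have := mulr_gt0 e0 eta0; lra.
have e1 : e < 1.
  by rewrite ltr_pdivrMr// mul1r; lra.
pose kap := N * (1 - e).
have kap0 : 0 < kap by rewrite mulr_gt0// subr_gt0.
have kapN : kap < N by have := mulr_gt0 N0 e0; rewrite /kap; lra.
have := nogap kap; rewrite kap0 kapN => /(_ isT).
move=> /existsNP[f /existsNP[a /not_implyP[[a0 fa] /not_andP]]].
case=> [|/existsNP[s /not_implyP[us /not_implyP[_ /negP]]]].
  by rewrite mulr_ge0// ltW.
rewrite -ltNge => s_big.
(* Restricting [f] to [Z] makes its support finite without changing the values of the operator on
   [s]. *)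
pose Z := undup [seq (x * g)%g | x <- s, g <- F].
pose f' x := if x \in Z then f x else 0.
pose M := \sum_(x <- Z) f' x ^+ 2.
have uZ : uniq Z by exact: undup_uniq.
have f'0 x : x \notin Z -> f' x = 0 by rewrite /f' => /negPf ->.
have Ma : M <= a ^+ 2.
  rewrite /M (eq_big_seq (fun x => f x ^+ 2)); first by apply: fa.
  by move=> x xZ; rewrite /f' xZ.
have M0 : 0 <= M by apply: sumr_ge0 => x _; exact: sqr_ge0.
(* [X] contains [s], the support of [f'] and the supports of its translates by [F]. *)
pose X := undup (s ++ Z ++ [seq (z * t^-1)%g | z <- Z, t <- F]).
have uX : uniq X by exact: undup_uniq.
have sX : {subset s <= X} by move=> x xs; rewrite mem_undup mem_cat xs.
have T_big : (kap * a) ^+ 2 < \sum_(x <- X) (tsum *%g F f' x) ^+ 2.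
  apply: lt_le_trans s_big _.
  rewrite (eq_big_seq (fun x => tsum *%g F f' x ^+ 2)).
    by apply: ler_sum_subseq => // x; exact: sqr_ge0.
  move=> x xs; congr (_ ^+ 2); apply: eq_big_seq => g gF.
  rewrite /f' ifT// mem_undup; apply/allpairsP; by exists (x, g).
have l2f' : l2le setT f' (Num.sqrt M).
  split=> [|r ur _]; first exact: sqrtr_ge0.
  rewrite sqr_sqrtr//.
  pose Y := undup (r ++ Z).
  have -> : M = \sum_(x <- Y) f' x ^+ 2.
    rewrite /M; apply/esym/sum_eq_supp; rewrite ?undup_uniq//.
      by move=> x xZ; rewrite mem_undup mem_cat xZ orbT.
    by move=> x /f'0 ->; rewrite expr0n.
  apply: ler_sum_subseq; rewrite ?undup_uniq// => x; last by rewrite sqr_ge0.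
  move=> xr.
  by rewrite mem_undup mem_cat xr.
have shift g : \sum_(x <- X) f' (x * g)%g ^+ 2 <= M.
  have := l2le_act (@mulg1 G) (fun x g h => esym (mulgA x g h))
    (D := setT) (g := g) (fun x _ => I) l2f'.
  by move=> [_ /(_ X uX)]; rewrite sqr_sqrtr//; apply.
have M_gt0 : 0 < M.
  rewrite lt_def M0 andbT; apply/eqP => M_eq0.
  have := le_lt_trans (sqr_ge0 _) T_big.
  rewrite big1 ?ltxx// => x _; rewrite [tsum _ _ _ _]big1_seq ?expr0n// => g /andP[_ gF].
  apply/eqP; rewrite -sqrf_eq0 eq_le sqr_ge0 andbT -M_eq0.
  have := l2f'.2 [:: (x * g)%g] isT (fun _ _ => I).
  by rewrite big_seq1 sqr_sqrtr.
exists Z, X, f'; split => //.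
  split=> [x xZ|z t zZ tF]; rewrite mem_undup !mem_cat.
    by rewrite xZ orbT.
  by apply/orP; right; apply/orP; right; apply/allpairsP; exists (z, t).
move=> t tF; rewrite -/M.
apply: (@le_trans _ _ (4 * (N * M - (kap * a) ^+ 2 / N))).
  apply: (@le_trans _ _ (\sum_(x <- X) 4 * (\sum_(g <- F) f' (x * g)%g ^+ 2 -
      (tsum *%g F f' x) ^+ 2 / N))).
    apply: ler_sum => x _.
    by have := sqr_dist_le_variance (fun g => f' (x * g)%g) tF F1; rewrite mulg1.
  rewrite -mulr_sumr sumrB -mulr_suml exchange_big/=.
  rewrite ler_wpM2l// lerB//.
    apply: le_trans (ler_sum _ (fun g _ => shift g)) _.
    by rewrite big_const_seq iter_addr_0 count_predT mulr_natl.
  by rewrite ler_pM2r ?invr_gt0// ltW.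
have kM : kap ^+ 2 * M <= (kap * a) ^+ 2 by rewrite [leRHS]exprMn ler_wpM2l// sqr_ge0.
apply: (@le_trans _ _ (4 * (N * M - kap ^+ 2 * M / N))).
  by rewrite ler_wpM2l// lerB// ler_pM2r// invr_gt0.
have -> : kap ^+ 2 * M / N = N * (1 - e) ^+ 2 * M.
  have -> : kap ^+ 2 * M / N = (N / N) * (N * (1 - e) ^+ 2 * M) by rewrite /kap; lra.
  by rewrite mulfV ?gt_eqF// mul1r.
have := ler_wpM2r M0 eN; have : 0 <= 4 * N * e ^+ 2 * M.
  apply: mulr_ge0 => //; apply: mulr_ge0; last exact: sqr_ge0.
  by rewrite mulr_ge0// ltW.
lra.
Qed.

End Gap.

Section NonamenableGap.
Context {R : realType} {G : groupType} (H : subgroup_space G).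

(** With [rep x] a chosen point of the left coset of [x], take [x^-1 * rep x]. The map carries
    measures on the group to [H] and turns right translations by [H] into left ones. *)
Lemma left_coset_projection : exists pi : G -> subgroup_type H,
  forall x (g : subgroup_type H), pi (x * \val g)%g = (g^-1 * pi x)%g.
Proof.
pose rep x := xget 1%g [set y | (y^-1 * x)%g \in H].
have repP x : (x^-1 * rep x)%g \in H.
  rewrite /rep; case: xgetP => [y _ /= /subVg|/(_ x)/=]; first by rewrite invgM invgK.
  by rewrite mulVg => -[]; exact: sub1g.
have rep_shift x (g : subgroup_type H) : rep (x * \val g)%g = rep x.
  congr (xget 1%g _); apply/seteqP; split => y /=; rewrite mulgA.
    by move=> /subMg/(_ (subVg (valP g))); rewrite mulgK.
  by move=> /subMg/(_ (valP g)).
exists (fun x => exist (fun y => y \in H) _ (repP x)) => x g; apply: val_inj.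
by rewrite gmulfM/= rep_shift invgM mulgA.
Qed.

(** Without a gap, almost maximising vectors [f] exist for every finite part of [H]; the normalised
    densities [f ^+ 2], pushed to [H], are almost invariant means. *)
Lemma nonamenable_gap : ~ amenable R (subgroup_type H) ->
  exists (F : seq G) (kap : R),
    [/\ uniq F, 1%g \in F, {subset F <= H}, 0 < kap < (size F)%:R & gap F kap].
Proof.
move=> namH; apply: contrapT => nogap; apply: namH.
apply: amenable_of_almost_invariant => F0 e e0.
pose F := undup (1%g :: [seq \val g | g <- F0]).
have F1 : 1%g \in F by rewrite mem_undup mem_head.
have FH : {subset F <= H}.
  move=> x; rewrite mem_undup inE => /orP[/eqP->|/mapP[g _ ->]]; first exact: sub1g.
  exact: valP.
(* The final error is at most [6 * c * M]: two contributions [c * M] and one [4 * c * M]. The bound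
   [c <= 1] absorbs [c ^+ 3] into [c]. *)
pose c := Num.min 1 (e / 6).
have c0 : 0 < c by rewrite lt_min ltr01 divr_gt0.
have c1 : c <= 1 by rewrite ge_min lexx.
have ce : 6 * c <= e by rewrite mulrC -ler_pdivlMr// ge_min lexx orbT.
have [|Z [X [f [[uZ uX] [fZ M0] [ZX ZtX] almost]]]] :=
    @almost_invariant_of_not_gap R G F (c ^+ 2) (undup_uniq _) F1 (exprn_gt0 _ c0).
  by move=> kap kapF gapF; apply: nogap; exists F, kap; split; rewrite ?undup_uniq.
set M := \sum_(x <- Z) _ in M0 almost.
have [pi piM] := left_coset_projection.
pose I (A : set (subgroup_type H)) x : R := `[< A (pi x) >]%:R.
pose mu A := M^-1 * \sum_(x <- Z) I A x * f x ^+ 2.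
have I0 A x : 0 <= I A x by [].
have I1 A x : I A x <= 1 by rewrite /I; case: asbool.
exists mu; split=> [A||A B AB|g A gF0].
- by rewrite mulr_ge0 ?invr_ge0 ?(ltW M0)// sumr_ge0// => x _; rewrite mulr_ge0 ?sqr_ge0.
- rewrite /mu (eq_bigr (fun x => f x ^+ 2)) => [|x _]; first by rewrite mulVf// gt_eqF.
  by rewrite /I asboolT// mul1r.
- rewrite /mu -mulrDr -big_split/=; congr (_ * _); apply: eq_bigr => x _.
  rewrite -mulrDl; congr (_ * _); rewrite /I.
  have [Ax|Ax] := pselect (A (pi x)); have [Bx|Bx] := pselect (B (pi x)).
  + by have : (A `&` B) (pi x) by []; rewrite AB.
  + by rewrite (asboolT (or_introl Ax)) (asboolT Ax) (asboolF Bx) addr0.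
  + by rewrite (asboolT (or_intror Bx)) (asboolT Bx) (asboolF Ax) add0r.
  + by rewrite (asboolF Ax) (asboolF Bx) asboolF ?addr0// => -[].
set t := \val g; have tF : t \in F by rewrite mem_undup inE map_f ?orbT.
have Ig x : I [set (g * y)%g | y in A] x = I A (x * t)%g.
  rewrite /I piM; congr (_%:R); congr nat_of_bool; apply: asbool_equiv_eq; split.
    by move=> [y Ay <-]; rewrite mulKg.
  by move=> Ax; exists (g^-1 * pi x)%g => //; rewrite mulVKg.
have E1 : \sum_(x <- Z) I [set (g * y)%g | y in A] x * f x ^+ 2 =
    \sum_(x <- X) I A (x * t)%g * f x ^+ 2.
  rewrite (eq_bigr (fun x => I A (x * t)%g * f x ^+ 2)) => [|x _]; last by rewrite Ig.
  by apply/esym/sum_eq_supp => // x /fZ ->; rewrite expr0n mulr0.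
have E2 : \sum_(x <- Z) I A x * f x ^+ 2 =
    \sum_(x <- X) I A (x * t)%g * f (x * t)%g ^+ 2.
  pose Zt := [seq (z * t^-1)%g | z <- Z].
  rewrite (@sum_eq_supp _ _ Zt X)//.
  - by rewrite big_map; apply: eq_bigr => x _; rewrite mulgVK.
  - by rewrite map_inj_uniq//; exact: mulIg.
  - by move=> _ /mapP[z zZ ->]; exact: ZtX.
  - move=> x xZt; rewrite fZ ?expr0n ?mulr0//; apply: contra xZt => xtZ.
    by apply/mapP; exists (x * t)%g => //; rewrite mulgK.
rewrite /mu -mulrBr E1 E2 -sumrB normrM ger0_norm ?invr_ge0 ?(ltW M0)//.
rewrite ler_pdivrMl//.
have sumX : \sum_(x <- X) f x ^+ 2 = M.
  by apply: sum_eq_supp => // x /fZ ->; rewrite expr0n.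
have cV : c^-1 * c = 1 by rewrite mulVf// gt_eqF.
(* A difference of squares is a product of difference and sum; the inequality of means with
   parameter [c] puts the weight [c^-1] on the small factor. *)
have term x : `|I A (x * t)%g * f x ^+ 2 - I A (x * t)%g * f (x * t)%g ^+ 2| <=
    c^-1 * (f (x * t)%g - f x) ^+ 2 + c * ((f (x * t)%g - f x) ^+ 2 + 4 * f x ^+ 2).
  rewrite -mulrBr normrM ger0_norm//.
  apply: le_trans (ler_piMl _ (I1 A _)) _; first exact: normr_ge0.
  rewrite subr_sqr normrM distrC.
  move: (f x) (f (x * t)%g) => a b.
  have h : 2 * (`|b - a| * `|a + b|) <= c^-1 * `|b - a| ^+ 2 + c * `|a + b| ^+ 2.
    have := mulr_ge0 (ltW (_ : 0 < c^-1)) (sqr_ge0 (`|b - a| - c * `|a + b|)).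
    rewrite invr_gt0 => /(_ c0).
    have -> : c^-1 * (`|b - a| - c * `|a + b|) ^+ 2 = c^-1 * `|b - a| ^+ 2
       - 2 * (c^-1 * c) * (`|b - a| * `|a + b|) + (c^-1 * c) * (c * `|a + b| ^+ 2) by lra.
    by rewrite cV; lra.
  rewrite !real_normK ?num_real// in h.
  have h1 : 0 <= c^-1 * (b - a) ^+ 2 by rewrite mulr_ge0 ?sqr_ge0// invr_ge0 ltW.
  have h2 : c * (a + b) ^+ 2 <= c * (2 * ((b - a) ^+ 2 + 4 * a ^+ 2)).
    by rewrite ler_pM2l//; have := sqr_ge0 (b - a - 2 * a); lra.
  lra.
apply: le_trans (ler_norm_sum _ _ _) _.
apply: le_trans (ler_sum _ (fun x _ => term x)) _.
rewrite big_split/= -!mulr_sumr big_split/= -mulr_sumr sumX.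
have := almost t tF; move: (\sum_(x <- X) _) => D DM.
have D1 : c^-1 * D <= c * M.
  by rewrite ler_pdivrMl// mulrA -expr2.
have D2 : c * D <= c * M.
  rewrite ler_pM2l//; apply: le_trans DM _.
  by rewrite ler_piMl ?(ltW M0)// expr_le1// ltW.
have := ler_wpM2r (ltW M0) ce; lra.
Qed.

End NonamenableGap.

(** * Weighted walks *)

Fixpoint words (T : Type) (V : seq T) n : seq (seq T) :=
  if n is n'.+1 then [seq v :: s | v <- V, s <- words V n'] else [:: [::]].

Section WeightedWalk.
Context {R : realType} {G : groupType}.
Implicit Types (V : seq (G * bool)) (c f : G -> R) (x : G) (s : seq (G * bool)).

(* Steps flagged [true] are weighted by the value of [c] at their starting
   point. *)
Definition weighted_op V c f x : R :=
  \sum_(v <- V) (if v.2 then c x else 1) * f (x * v.1)%g.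

Fixpoint flagged x s : seq G :=
  if s is v :: s' then
    let r := flagged (x * v.1)%g s' in if v.2 then x :: r else r
  else [::].

Fixpoint endpoint x s : G :=
  if s is v :: s' then endpoint (x * v.1)%g s' else x.

(** The expansion isolates the weight of each walk as a product over its points, the form to which
    Jensen's inequality applies. *)
Lemma iter_weighted_op V c n f x : iter n (weighted_op V c) f x =
  \sum_(s <- words V n) (\prod_(g <- flagged x s) c g) * f (endpoint x s).
Proof.
elim: n x => [|n IH] x; first by rewrite big_seq1 big_nil mul1r.
rewrite iterS {1}/weighted_op/= big_allpairs_dep/=; apply: eq_bigr => v _.
rewrite IH mulr_sumr; apply: eq_bigr => s _; rewrite mulrA; congr (_ * _).
by case: v.2; rewrite ?big_cons ?mul1r.
Qed.

End WeightedWalk.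

Section Fibers.
Context {R : realType} {G : groupType} (H : subgroup_space G).
Variables (W F : seq G) (kap : R).
Hypothesis kap_gt0 : 0 < kap.
Hypothesis gapF : gap F kap.
Implicit Types (f : G -> R) (Phi : rcosets_set H -> R).

Definition steps := [seq (g, false) | g <- W] ++ [seq (g, true) | g <- F].

Lemma weighted_op_steps (c f : G -> R) x :
  weighted_op steps c f x = tsum *%g W f x + c x * tsum *%g F f x.
Proof.
rewrite /weighted_op big_cat !big_map/=; congr (_ + _).
  by apply: eq_bigr => g _; rewrite mul1r.
by rewrite /tsum mulr_sumr.
Qed.

Definition good x := all (fun t => (x * t * x^-1)%g \in H) F.

Let z := (size F)%:R / kap.

Definition good_weight x := if good x then z else 1.

(** The invariant of the induction: walks in the group are controlled fiber by fiber over the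
    Schreier graph. *)
Let fiberwise_le f Phi := forall y, l2le (set_val y) f (Phi y).

Let good_coset x h : h \in H -> good (h * x)%g = good x.
Proof.
move=> hH; apply: eq_all => t.
have -> : (h * x * t * (h * x)^-1 = h * (x * t * x^-1) * h^-1)%g.
  by rewrite invgM !mulgA.
apply/idP/idP => [|xH]; last exact/subMg/subVg/hH/subMg.
move=> /(subMg (subVg hH))/subMg/(_ hH).
by rewrite -!mulgA mulVg mulg1 mulKg.
Qed.

(* On a coset fixed by the steps in [F], averaging over [F] contracts the norm
   of the fiber, so that the weight [z] is harmless. *)
Let fiberwise_step f Phi : fiberwise_le f Phi ->
  fiberwise_le (weighted_op steps good_weight f)
    (tsum (@schreier_step G H) (W ++ F) Phi).
Proof.
move=> fPhi y; have [x0 yE] := vtxP y.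
have yP x : set_val y x -> exists2 h, h \in H & x = (h * x0)%g.
  by rewrite yE => -[h hH <-]; exists h.
have shift g : l2le (set_val y) (fun x => f (x * g)%g) (Phi (schreier_step y g)).
  apply: (l2le_act (@mulg1 G) (fun x g h => esym (mulgA x g h)) _
    (fPhi (schreier_step y g))) => x yx.
  by exists x.
rewrite /tsum big_cat/=.
have W_le : l2le (set_val y) (tsum *%g W f) (\sum_(g <- W) Phi (schreier_step y g)).
  by apply: l2le_sum => g _; exact: shift.
have [x0_good|x0_bad] := boolP (good x0); last first.
  have F_le : l2le (set_val y) (tsum *%g F f) (\sum_(g <- F) Phi (schreier_step y g)).
    by apply: l2le_sum => g _; exact: shift.
  apply: l2le_eq (l2leD W_le F_le) => x; rewrite inE => /yP[h hH ->].
  by rewrite weighted_op_steps /good_weight good_coset// (negPf x0_bad) mul1r.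
have stepF g : g \in F -> schreier_step y g = y.
  move=> gF; rewrite yE schreier_stepE; apply/vtx_eqP.
  move/allP: x0_good => /(_ g gF)/subVg.
  by rewrite !invgM !invgK !mulgA.
(* The gap concerns functions on the whole group, so [f] is cut off outside the coset; steps in [F]
   do not leave it. *)
pose f' x := if `[< set_val y x >] then f x else 0.
have f'le : l2le setT f' (Phi y).
  have [Phi0 fy] := fPhi y; split=> // s us _.
  rewrite (bigID (fun x => `[< set_val y x >]))/= [X in _ + X]big1 ?addr0; last first.
    by move=> x /negPf; rewrite /f' => ->; rewrite expr0n.
  rewrite (eq_bigr (fun x => f x ^+ 2)) => [|x]; last by rewrite /f' => ->.
  rewrite -big_filter; apply: fy; first exact: filter_uniq.
  by move=> x; rewrite mem_filter => /andP[/asboolP].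
(* All [F]-steps fix the vertex [y]; their number is [z * kap], so the gap exactly compensates the
   weight [z]. *)
have -> : \sum_(g <- F) Phi (schreier_step y g) = z * (kap * Phi y).
  rewrite mulrA divfK ?gt_eqF// (eq_big_seq (fun=> Phi y)); last first.
    by move=> g /stepF ->.
  by rewrite big_const_seq iter_addr_0 count_predT mulr_natl.
have z0 : 0 <= z by rewrite divr_ge0// ltW.
have F_le := l2leZ z0 (l2le_sub (@subsetT _ (set_val y)) (gapF f'le)).
apply: l2le_eq (l2leD W_le F_le) => x; rewrite inE => yx.
rewrite weighted_op_steps; congr (_ + _).
have [h hH xE] := yP x yx.
rewrite /good_weight {2}xE good_coset// x0_good; congr (_ * _).
apply: eq_big_seq => g gF; rewrite /f' ifT//; apply/asboolP.
by rewrite -(stepF g gF); exists x.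
Qed.

Lemma iter_weighted_op_le n :
  iter n (weighted_op steps good_weight) dirac1 1%g <=
  iter n (tsum (@schreier_step G H) (W ++ F)) (@dirac_root R G H) (vtx H 1%g).
Proof.
suff : fiberwise_le (iter n (weighted_op steps good_weight) dirac1)
    (iter n (tsum (@schreier_step G H) (W ++ F)) (@dirac_root R G H)).
  move=> /(_ (vtx H 1%g)); apply: l2le_point.
  by exists 1%g; [exact: sub1g|rewrite mulg1].
elim: n => [|n IH] y /=; last exact: fiberwise_step.
rewrite /dirac_root; case: eqP => [_|y1]; first exact: l2le_dirac.
apply: l2le0 => x; rewrite inE /dirac1; case: eqP => // -> yx; case: y1.
have [x0 yE] := vtxP y; move: yx; rewrite yE => -[h hH hx0].
by apply/vtx_eqP; rewrite mul1g -(mulg1_eq hx0) invgK.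
Qed.

End Fibers.

(** * Averaging weights over random events *)

Section Events.
Context {R : realType} {d : measure_display} {Omega : measurableType d}.
Variable P : probability Omega R.

Lemma ae_weighted_events_le (I : Type) (r : seq I) (E : I -> set Omega)
    (c : I -> R) (p D : R) : (forall i, measurable (E i)) ->
  (forall i, P (E i) = p%:E) -> (forall i, 0 <= c i) ->
  {ae P, forall w, \sum_(i <- r) c i * \1_(E i) w <= D} ->
  \sum_(i <- r) c i * p <= D.
Proof.
move=> mE PE c0 aeD.
have T0 w : 0 <= \sum_(i <- r) c i * \1_(E i) w.
  by apply: sumr_ge0 => i _; rewrite mulr_ge0.
have D0 : 0 <= D.
  (* The integral comparison needs a nonnegative bound; it is read off at one sample point where the
     inequality holds. *)
  have Ppos : (0 < P setT)%E by rewrite probability_setT.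
  have PF := ae_properfilter_algebraOfSetsType Ppos.
  by have [w /(le_trans (T0 w))] := filter_ex aeD.
have mfE i : measurable_fun setT (fun w => c i * \1_(E i) w : R).
  by apply: measurable_funM => //; exact: measurable_indic.
have : (\int[P]_w (\sum_(i <- r) c i * \1_(E i) w)%:E <= \int[P]_w D%:E)%E.
  apply: ae_ge0_le_integral => //.
  - by move=> w _; rewrite lee_fin.
  - by apply/measurable_EFinP; apply: measurable_sum.
  - exact: filterS aeD.
have -> : (\int[P]_w D%:E = D%:E)%E.
  rewrite integral_cst// -[RHS]mule1; congr (_ * _)%E; exact: probability_setT.
under eq_integral do rewrite -sumEFin.
rewrite ge0_integral_sum//; first last.
- by move=> i w _; rewrite lee_fin mulr_ge0.
- by move=> i; apply/measurable_EFinP.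
rewrite (eq_bigr (fun i => (c i * p)%:E)) ?sumEFin ?lee_fin// => i _.
under eq_integral do rewrite EFinM.
rewrite ge0_integralZl_EFin//.
- rewrite integral_indic// setIT EFinM; congr (_ * _)%E; exact: PE.
- by apply/measurable_EFinP; exact: measurable_indic.
Qed.

(* The tangent of [expR] at the mean bounds each product below by a linear
   combination of indicators. *)
Lemma ae_jensen (I : Type) (r : seq I) (J : eqType) (q : I -> seq J)
    (E : Omega -> J -> bool) (b : I -> R) (p z C : R) :
  (forall j, measurable [set w | E w j]) ->
  (forall j, P [set w | E w j] = p%:E) -> (forall i, 0 <= b i) -> 1 <= z ->
  {ae P, forall w, \sum_(i <- r)
     (\prod_(j <- q i) (if E w j then z else 1)) * b i <= C} ->
  \sum_(i <- r) expR (p * ln z) ^+ size (q i) * b i <= C.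
Proof.
move=> mE PE b0 z1 aeC; set th := ln z.
have th0 : 0 <= th by exact: ln_ge0.
have zE : z = expR th by rewrite lnK// posrE (lt_le_trans ltr01).
set y := expR (p * th).
(* The exponent [th * N] has mean [p * th * k], where [k] is the length of [q i]. Of the tangent
   there, multiplied by [b i], [c] is the coefficient of each indicator and [A] the constant
   term. *)
pose c (ij : I * J) := b ij.1 * y ^+ size (q ij.1) * th.
pose rq := [seq (i, j) | i <- r, j <- q i].
pose A i := b i * y ^+ size (q i) * (1 - p * th * (size (q i))%:R).
have c0 ij : 0 <= c ij by rewrite !mulr_ge0// exprn_ge0// expR_ge0.
have := @ae_weighted_events_le _ rq (fun ij => [set w | E w ij.2]) c p
  (C - \sum_(i <- r) A i) (fun ij => mE ij.2) (fun ij => PE ij.2) c0.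
have sum_rq (F : J -> R) : \sum_(ij <- rq) c ij * F ij.2 =
    \sum_(i <- r) b i * y ^+ size (q i) * (th * \sum_(j <- q i) F j).
  rewrite /rq big_allpairs_dep/=; apply: eq_bigr => i _.
  by rewrite !mulr_sumr; apply: eq_bigr => j _; rewrite /c/= mulrA.
rewrite (sum_rq (fun=> p)) => main.
rewrite -subr_ge0.
have -> : C - \sum_(i <- r) y ^+ size (q i) * b i = C - \sum_(i <- r) A i -
    \sum_(i <- r) b i * y ^+ size (q i) * (th * \sum_(j <- q i) p).
  rewrite -addrA -opprD -big_split/=; congr (_ - _); apply: eq_bigr => i _.
  rewrite /A big_const_seq iter_addr_0 count_predT -mulr_natl; lra.
rewrite subr_ge0; apply: main; apply: filterS aeC => w wC.
rewrite lerBrDr (sum_rq (fun j => \1_[set w | E w j] w)) -big_split/=.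
apply: le_trans wC.
apply: ler_sum => i _; set N := \sum_(j <- q i) _; set k := size (q i).
have -> : \prod_(j <- q i) (if E w j then z else 1) = expR (th * N).
  rewrite /N mulr_sumr expR_sum; apply: eq_bigr => j _.
  rewrite indicE; have [Ej|Ej] := boolP (E w j).
    by rewrite mem_set// mulr1.
  by rewrite memNset ?mulr0 ?expR0//; exact/negP.
have -> : expR (th * N) = y ^+ k * expR (th * N - p * th * k%:R).
  by rewrite /y -expRM_natr -expRD; congr expR; lra.
have bE : 0 <= b i * y ^+ k by rewrite mulr_ge0// exprn_ge0// expR_ge0.
have := ler_wpM2l bE (expR_ge1Dx (th * N - p * th * k%:R)).
rewrite /A -/k; lra.
Qed.

End Events.

Section SubgroupEvents.
Context {G : groupType}.

Lemma measurable_subset_event (F : seq G) :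
  measurable [set K : borel_subgroups G | all (fun t => t \in (K : subgroup_space G)) F].
Proof.
elim: F => [|t F IH].
  by rewrite (_ : mkset _ = setT)//; apply/seteqP; split.
rewrite (_ : mkset _ = [set K : borel_subgroups G | t \in (K : subgroup_space G)] `&`
    [set K : borel_subgroups G | all (fun t => t \in (K : subgroup_space G)) F]); last first.
  by apply/seteqP; split => K /=; [move=> /andP|move=> []->].
apply: measurableI => //; apply: sub_sigma_algebra.
have oW : open [set f : {ptws G -> bool} | f t].
  have -> : [set f : {ptws G -> bool} | f t] = proj t @^-1` [set true].
    by apply/seteqP; split => f; rewrite /= /proj => ->.
  by apply: open_comp => [f _|]; [exact: proj_continuous|exact: discrete_open].
have := @initial_continuous (@subgroup_set G) _ set_val.
move=> /continuousP/(_ _ oW); exact.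
Qed.

End SubgroupEvents.

(** * From a power of an operator back to the operator *)

Section PowersOfOperators.
Context {R : realType} {G : groupType}.
Implicit Types (W X : seq G) (u : G -> R).

Lemma tsum_scale W c u x : tsum *%g W (fun y => c * u y) x = c * tsum *%g W u x.
Proof. by rewrite /tsum mulr_sumr. Qed.

Lemma tsum_add W u v x :
  tsum *%g W (fun y => u y + v y) x = tsum *%g W u x + tsum *%g W v x.
Proof. by rewrite /tsum big_split. Qed.

(* [v = \sum_(j < L) c ^+ (L.-1 - j) X^j u] telescopes to
   [X v - c v = X^L u - c^L u]. *)
Lemma superharmonic_root X (c : R) u L : (0 < L)%N -> 0 < c ->
  (forall x, 0 < u x) ->
  (forall x, iter L (tsum *%g X) u x <= c ^+ L * u x) ->
  exists v : G -> R, (forall x, 0 < v x) /\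
    (forall x, tsum *%g X v x <= c * v x).
Proof.
move=> L0 c0 u0 uL.
have Xu0 n x : 0 <= iter n (tsum *%g X) u x.
  elim: n x => [|n IH] x /=; first exact: ltW.
  by apply: sumr_ge0 => g _; exact: IH.
suff [v [v0 vL]] : exists v : G -> R, (forall x, 0 < v x) /\ forall x,
    tsum *%g X v x - c * v x = iter L (tsum *%g X) u x - c ^+ L * u x.
  by exists v; split => // x; rewrite -subr_le0 vL subr_le0.
case: L L0 uL => // L _ _; elim: L => [|L [v [v0 vL]]].
  by exists u; split => // x /=; rewrite expr1.
exists (fun x => iter L.+1 (tsum *%g X) u x + c * v x); split => x.
  by apply: ltr_wpDl; [exact: Xu0|exact: mulr_gt0].
rewrite tsum_add tsum_scale [c ^+ L.+2]exprS [iter L.+2 _ _]iterS.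
have -> : tsum *%g X v x = c * v x + (iter L.+1 (tsum *%g X) u x - c ^+ L.+1 * u x).
  by rewrite -vL addrC subrK.
move: (iter L.+1 _ u x) (c ^+ L.+1) (tsum _ _ _ _) => a k e; lra.
Qed.

Lemma exists_root (B b : R) L : 0 < b -> B < b ^+ L ->
  exists c, [/\ 0 < c, c < b & B <= c ^+ L].
Proof.
move=> b0 BbL.
have bernoulli (e : R) n : 0 <= e <= 1 -> 1 - n%:R * e <= (1 - e) ^+ n.
  move=> /andP[e0 e1]; elim: n => [|n IH]; first by rewrite mul0r subr0 expr0.
  rewrite exprS; have e1' : 0 <= 1 - e by rewrite subr_ge0.
  apply: le_trans (ler_wpM2l e1' IH); rewrite -natr1.
  have : 0 <= n%:R * e * e by rewrite !mulr_ge0.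
  lra.
have bL0 : 0 < b ^+ L by rewrite exprn_gt0.
(* The first bound keeps [1 - e] positive, the second makes the loss in Bernoulli's inequality at
   most [b ^+ L - B]; [L.+1] avoids division by 0. *)
pose e := Num.min (2^-1) ((b ^+ L - B) / b ^+ L / L.+1%:R).
have e0 : 0 < e by rewrite lt_min invr_gt0 ltr0n/= !divr_gt0// subr_gt0.
have e1 : e <= 2^-1 by rewrite ge_min lexx.
have eL : e * L.+1%:R <= (b ^+ L - B) / b ^+ L.
  by rewrite -ler_pdivlMr// ge_min lexx orbT.
exists (b * (1 - e)); split.
- by rewrite mulr_gt0// subr_gt0; lra.
- by have := mulr_gt0 b0 e0; lra.
rewrite exprMn; have e01 : 0 <= e <= 1 by rewrite ltW//=; lra.
apply: le_trans (ler_wpM2l (ltW bL0) (bernoulli e L e01)).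
have := ler_wpM2l (ltW bL0) eL; rewrite [b ^+ L * (_ / _)]mulrC divfK ?gt_eqF//.
rewrite -natr1 => h; have : 0 <= b ^+ L * e by rewrite mulr_ge0// ltW.
lra.
Qed.

End PowersOfOperators.

Section WordsCover.
Context {G : groupType}.
Implicit Types (W X F : seq G).

Lemma mem_prods_le X m n x :
  1%g \in X -> (m <= n)%N -> x \in prods X m -> x \in prods X n.
Proof.
move=> X1 /subnKC <- xm; rewrite -[x]mulg1; apply: mem_prodsM => //.
elim: (n - m)%N => [|k IH]; first by rewrite inE.
by apply/allpairsP; exists (1%g, 1%g); split; rewrite //= mulg1.
Qed.

Lemma sub_prods X W n : {subset X <= W} -> {subset prods X n <= prods W n}.
Proof.
move=> XW; elim: n => [|n IH] //= x /allpairsP[[g h] [/= gX hn ->]].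
by apply/allpairsP; exists (g, h); split; [exact: XW|exact: IH|].
Qed.

(** Words can be padded by the identity, so a common length serves all elements of [F]. *)
Lemma prods_cover X F : 1%g \in X -> (forall x, exists n, x \in prods X n) ->
  exists2 L, (0 < L)%N & {subset F <= prods X L}.
Proof.
move=> X1 gen; elim: F => [|t F [L L0 FL]]; first by exists 1%N.
have [n tn] := gen t; exists (maxn L n); first by rewrite leq_max L0.
move=> x; rewrite inE => /orP[/eqP ->|/FL].
  exact: mem_prods_le (leq_maxr _ _) tn.
exact: mem_prods_le (leq_maxl _ _).
Qed.

End WordsCover.

(** One occurrence of each element of [F] is split off from the multiset [W]. *)
Lemma perm_cat_sub (T : eqType) (F W : seq T) : uniq F -> {subset F <= W} ->
  exists W', perm_eq W (W' ++ F).
Proof.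
move=> uF FW; have /perm_to_subseq[W' WW'] :
    subseq [seq x <- undup W | x \in F] W.
  exact: subseq_trans (filter_subseq _ _) (undup_subseq W).
exists W'; apply: perm_trans WW' _; rewrite perm_catC perm_cat2l.
apply: uniq_perm => // [|x]; first by rewrite filter_uniq// undup_uniq.
by rewrite mem_filter mem_undup andb_idr// => /FW.
Qed.

Section StationaryEvents.
Context {R : realType} {G : groupType} {d : measure_display}.
Context {Omega : measurableType d} (P : probability Omega R).
Variables (H : {RV P >-> borel_subgroups G}) (irsH : invariant_random_subgroup H).

Lemma measurable_good F x : measurable [set w | good (H w) F x].
Proof.
have := measurable_funP H measurableT _
  (measurable_subset_event [seq (x * t * x^-1)%g | t <- F]).
rewrite setTI; congr measurable.
by apply/seteqP; split => w; rewrite /= all_map.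
Qed.

(** Goodness of [x] for a subgroup is goodness of the identity for its conjugate by [x], which has
    the same distribution. *)
Lemma stationary_good F x :
  P [set w | good (H w) F x] = P [set w | good (H w) F 1%g].
Proof.
have := irsH x (measurable_subset_event F).
rewrite /distribution /pushforward => irs.
transitivity (P (H @^-1` (conj_subgroup x @^-1`
    [set K : borel_subgroups G | all (fun t => t \in (K : subgroup_space G)) F]))).
  by congr (P _); apply/seteqP; split => w.
rewrite irs; congr (P _); apply/seteqP.
have goodE w : good (H w) F 1%g = all (fun t => t \in (H w : subgroup_space G)) F.
  by apply: eq_all => t; rewrite invg1 mulg1 mul1g.
by split => w; rewrite /= goodE.
Qed.

End StationaryEvents.

(** * Nonamenable invariant random subgroups *)

Section MeasurableKesten.
Context {R : realType} {G : groupType}.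
Variables (S : {fset G}) (symS : symmetric_set S) (genS : generates S).
Context {d : measure_display} {Omega : measurableType d}.
Variables (P : probability Omega R) (H : {RV P >-> borel_subgroups G}).
Hypothesis irsH : invariant_random_subgroup H.

Let rho0 : R := rho (trivial_subgroup G) S.

Hypothesis rhoH : {ae P, forall w, rho (H w) S = rho0 :> R}.

(** Bounds the norm of the identity plus the sum over [S], in the Cayley graph and almost surely in
    the Schreier graph. *)
Let b : R := 1 + #|` S|%:R * rho0.

Let X : seq G := 1%g :: S.

Let genX x : exists n, x \in prods X n.
Proof.
have [n xn] := generates_prods symS genS x; exists n.
by apply: sub_prods xn => y yS; rewrite inE yS orbT.
Qed.

Let walk_bound K W W' L n : perm_eq W W' -> W = prods X L -> rho K S = rho0 ->
  iter n (tsum (@schreier_step G K) W') (@dirac_root R G K) (vtx K 1%g) <=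
  (b ^+ L) ^+ n.
Proof.
move=> WW' WE rhoK; rewrite -[leRHS]mulr1.
apply: l2le_point (l2le_iter _ n (l2le_dirac setT (vtx K 1%g))) => // f a fa.
have stepX (h : rcosets_set K -> R) e : l2le setT h e ->
    l2le setT (tsum (@schreier_step G K) X h) (b * e).
  move=> he; rewrite mulrDl mul1r -rhoK.
  apply: l2le_eq (l2leD he (l2le_rho S he)) => y _.
  by rewrite /tsum big_cons schreier_step1.
apply: l2le_eq (l2le_iter stepX L fa) => y _.
rewrite (iter_tsum (@schreier_step1 G K) (@schreier_stepM G K)) -WE.
exact: perm_big.
Qed.

(** If the probability were positive, the weighted walks would yield a positive superharmonic
    function on the group that forces its spectral radius below [rho0]. *)
Lemma gap_event_null (F : seq G) (kap : R) : uniq F -> 1%g \in F ->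
  0 < kap < (size F)%:R -> gap F kap -> P [set w | good (H w) F 1%g] = 0%E.
Proof.
move=> uF F1 /andP[kap0 kapF] gapF.
set E := [set w | _]; have mE x := measurable_good H F x.
have PE x : P [set w | good (H w) F x] = (fine (P E))%:E.
  by rewrite stationary_good// fineK// fin_num_measure//; exact: mE.
set p := fine (P E) in PE; rewrite (PE 1%g); congr (_%:E).
apply: contrapT => /eqP p_neq0.
have p0 : 0 < p by rewrite lt_def p_neq0 fine_ge0.
have [L L0 FL] := prods_cover F (mem_head _ _ : 1%g \in X) genX.
have [W' WW'] := perm_cat_sub uF FL.
set W := prods X L in FL WW'.
pose z := (size F)%:R / kap; have z1 : 1 < z by rewrite ltr_pdivlMr// mul1r.
pose y := expR (p * ln z).
have eta0 : 0 < y - 1.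
  by rewrite subr_gt0 /y -expR0 ltr_expR mulr_gt0// ln_gt0.
have d0 (x : G) : 0 <= dirac1 x :> R by [].
(* Jensen's inequality replaces the random weight, [z] at good points and 1 elsewhere, by the
   constant [y]. *)
have weighted_le n : iter n (weighted_op (steps W' F) (fun=> y)) dirac1 1%g <=
    (b ^+ L) ^+ n :> R.
  rewrite iter_weighted_op.
  under eq_bigr do rewrite big_const_seq iter_mulr_1 count_predT.
  apply: (@ae_jensen _ _ _ P _ _ _ _ (fun w => good (H w) F) _ p z) => //.
    exact: ltW.
  apply: filterS rhoH => w rhow.
  apply: le_trans (walk_bound n WW' erefl rhow).
  apply: le_trans (iter_weighted_op_le (H w) W' kap0 gapF n).
  by rewrite iter_weighted_op.
(* As [F] contains the identity, one of its steps is a loop; its excess weight [y - 1] is the [eta]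
   of [walk_op]. *)
have walk_le n x : iter n (walk_op W (y - 1)) dirac1 x <=
    iter n (weighted_op (steps W' F) (fun=> y)) dirac1 x :> R.
  elim: n x => [|n IH] x //=.
  set f := iter n _ _ in IH *; set h := iter n _ _ in IH *.
  have f0 z' : 0 <= f z' by apply: iter_walk_op_ge0 => //; exact: ltW.
  have h0 z' : 0 <= h z' by exact: le_trans (IH z').
  rewrite weighted_op_steps /walk_op.
  have -> : tsum *%g W f x = tsum *%g W' f x + tsum *%g F f x.
    by rewrite /tsum (perm_big _ WW') big_cat.
  have W'le : tsum *%g W' f x <= tsum *%g W' h x by apply: ler_sum => g _.
  have Fle : tsum *%g F f x <= tsum *%g F h x by apply: ler_sum => g _.
  have hF : f x <= tsum *%g F h x.
    apply: le_trans Fle; rewrite /tsum (big_rem 1%g)//= mulg1 lerDl.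
    by apply: sumr_ge0.
  have := ler_wpM2l (ltW eta0) hF; lra.
have genW x : exists n, x \in prods W n.
  have [n xn] := genX x; exists n; apply: sub_prods xn => g gX.
  exact: mem_prods_le (mem_head _ _) L0 (mem_prods1 gX).
have rho0_ge0 : 0 <= rho0 by exact: rho_ge0.
have b1 : 1 <= b by rewrite lerDl mulr_ge0.
have b0 : 0 < b by exact: lt_le_trans ltr01 b1.
(* The Green function needs a constant above [b ^+ L]. Half of [y - 1] pays for this; the other half
   leaves a constant strictly below [b ^+ L] for [W] alone. *)
have [|u [u0 uW]] := @green R G W (y - 1) (ltW eta0) (b ^+ L)
    (b ^+ L + (y - 1) / 2) genW (exprn_ge0 _ (ltW b0))
    (fun n => le_trans (walk_le n 1%g) (weighted_le n)).
  by rewrite ltrDl divr_gt0.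
have [|c [c0 cb Bc]] := @exists_root R (b ^+ L - (y - 1) / 2) b L b0.
  by rewrite gtrBl divr_gt0.
have [|v [v0 vX]] := @superharmonic_root R G X c u L L0 c0 u0.
  move=> x; rewrite (iter_tsum (@mulg1 G) (fun x g h => esym (mulgA x g h))).
  apply: le_trans (ler_wpM2r (ltW (u0 x)) Bc).
  by have := uW x; rewrite /walk_op; lra.
(* Removing the identity from [X] lowers the constant by 1, to a value below the number of
   generators times [rho0]. *)
have vS x : tsum *%g S v x <= (c - 1) * v x.
  by have := vX x; rewrite /tsum big_cons mulg1; lra.
have c1 : 0 <= c - 1.
  have := le_trans (sumr_ge0 _ (fun s _ => ltW (v0 _))) (vS 1%g).
  by rewrite pmulr_lge0.
have := rho_le_of_superharmonic symS amenable_trivial v0 vS.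
rewrite -/rho0 leNgt => /negP; apply.
have cD : c - 1 < #|` S|%:R * rho0 by rewrite /b in cb; lra.
have S0 : 0 < #|` S|%:R :> R.
  rewrite ltr0n lt0n; apply/eqP => S0; move: cD; rewrite S0 mul0r.
  by rewrite ltNge c1.
by rewrite ltr_pdivrMl.
Qed.

(** A nonamenable value of [H] contains some finite list with a gap. There are countably many such
    lists, and each is contained in [H] with probability 0. *)
Lemma ae_amenable : {ae P, forall w, amenable R (subgroup_type (H w))}.
Proof.
(* A group element is coded by a word length and a position in [prods], so natural numbers enumerate
   all finite lists. *)
pose dec (k : nat) : seq G :=
  [seq nth 1%g (prods S ni.1) ni.2 | ni <- odflt [::] (choice.unpickle k)].
have decP F : exists k, dec k = F.
  suff [s sF] : exists s : seq (nat * nat),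
      [seq nth 1%g (prods S ni.1) ni.2 | ni <- s] = F.
    by exists (choice.pickle s); rewrite /dec choice.pickleK.
  elim: F => [|x F [s <-]]; first by exists [::].
  have [n xn] := generates_prods symS genS x.
  by exists ((n, index x (prods S n)) :: s); rewrite /= nth_index.
pose bad (F : seq G) := [/\ uniq F, 1%g \in F
  & exists2 kap : R, 0 < kap < (size F)%:R & gap F kap].
pose N k := [set w : Omega | bad (dec k) /\ good (H w) (dec k) 1%g].
suff : P.-negligible (\bigcup_k N k)%classic.
  apply: negligibleS.
  move=> w /= /nonamenable_gap[F [kap [uF F1 FH kapF gapF]]].
  have [k kF] := decP F; exists k => //; rewrite /N /= kF; split.
    by split=> //; exists kap.
  by apply/allP => t tF; rewrite invg1 mulg1 mul1g; exact: FH.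
apply: negligible_bigcup => k.
have [[uF F1 [kap kapF gapF]]|nbad] := pselect (bad (dec k)).
  exists [set w | good (H w) (dec k) 1%g]; split.
  - exact: measurable_good.
  - exact: gap_event_null kapF gapF.
  - by move=> w [].
by exists set0; split => // w [].
Qed.

End MeasurableKesten.

Theorem theorem3 (R : realType) (G : groupType) (S : {fset G})
    (symS : symmetric_set S) (genS : generates S)
    (d : measure_display) (Omega : measurableType d) (P : probability Omega R)
    (H : {RV P >-> borel_subgroups G})
    (irsH : invariant_random_subgroup H) :
  {ae P, forall w,
     spectral_radius R (schreier (H w) S) = spectral_radius R (cayley S)} <->
  {ae P, forall w, amenable R (subgroup_type (H w))}.
Proof.
split => [rhoH|amH].
  apply: (ae_amenable symS genS irsH); apply: filterS rhoH => w.
  by rewrite /cayley !rhoE => -[].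
by apply: filterS amH => w amw; rewrite /cayley !rhoE (amenable_rho symS genS amw).
Qed.
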